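(* Let $n\ge 1$ be an integer, $p,q\in[1,\infty)$ and $\lambda,\sigma,\alpha,\beta\in(0,\infty)$. Assume that $$\left(p>1\text{ and }0<\alpha<\tfrac{n+2}{2p}\right)\ \text{ or }\ \left(p=1\text{ and }0<\alpha\le\tfrac{n+2}{2p}\right),$$ $$\left(q>1\text{ and }0<\beta<\tfrac{n+2}{2q}\right)\ \text{ or }\ \left(q=1\text{ and }0<\beta\le\tfrac{n+2}{2q}\right),$$ that $(n+2-2p\alpha)q^2\sigma\le(n+2-2q\beta)p^2\lambda$, that $2p\alpha<n+2$, and that $$\sigma>\mu(\lambda):=\frac{2p\beta}{n+2-2p\alpha}+\frac{n+2}{(n+2-2p\alpha)\lambda}.$$ Let $\sigma_0=\frac{(n+2)p}{(n+2-2p\alpha)q}$ and $$s_0=\max\{q,q\sigma_0/\sigma\}=\begin{cases}q\sigma_0/\sigma&\text{if }\sigma\le\sigma_0\\ q&\text{if }\sigma>\sigma_0,\end{cases}$$ and let $r\in(p,\infty]$ and $s\in(s_0,\infty]$. Then there exist solutions $u\in Y^p_\alpha$ and $v\in Y^q_\beta$ of the initial value problem $$0\le(\partial_t-\Delta)^\alpha u\le v^\lambda,\qquad 0\le(\partial_t-\Delta)^\beta v\le u^\sigma\qquad\text{in }\mathbb{R}^n\times\mathbb{R},$$ $$u=v=0\quad\text{in }\mathbb{R}^n\times(-\infty,0),$$ and a sequence $\{t_j\}\subset(0,1)$ such that $\lim_{j\to\infty}t_j=0$ and $$\|v^\lambda\|_{L^r(R_j)}=\|(\partial_t-\Delta)^\alpha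 u\|_{L^r(R_j)}=\infty,\qquad\|u^\sigma\|_{L^s(R_j)}=\|(\partial_t-\Delta)^\beta v\|_{L^s(R_j)}=\infty$$ for $j=1,2,\dots$, where $$R_j=\{(x,t)\in\mathbb{R}^n\times\mathbb{R}:|x|<\sqrt{t_j}\text{ and }t_j<t<2t_j\}.$$
   Context: For $p\ge1$, $X^p:=\bigcap_{T\in\mathbb{R}}L^p(\mathbb{R}^n\times(-\infty,T))$, i.e. the set of measurable $f:\mathbb{R}^n\times\mathbb{R}\to\mathbb{R}$ with $\|f\|_{L^p(\mathbb{R}^n\times(-\infty,T))}<\infty$ for all $T\in\mathbb{R}$ (functions equal a.e. are identified). For $\alpha>0$ the fractional heat kernel is $$\Phi_\alpha(x,t):=\frac{t^{\alpha-1}}{\Gamma(\alpha)}\frac{1}{(4\pi t)^{n/2}}e^{-|x|^2/(4t)}\chi_{(0,\infty)}(t),$$ and $$J_\alpha f(x,t):=\iint_{\mathbb{R}^n\times(-\infty,t)}\Phi_\alpha(x-\xi,t-\tau)f(\xi,\tau)\,d\xi\,d\tau .$$ Set $Y^p_\alpha:=J_\alpha(X^p)$. When ($p>1$ and $0<\alpha<\frac{n+2}{2p}$) or ($p=1$ and $0<\alpha\le\frac{n+2}{2p}$), it is known that $J_\alpha f\in L^p_{\rm loc}(\mathbb{R}^n\times\mathbb{R})$ for $f\in X^p$ and that $J_\alpha:X^p\to Y^p_\alpha$ is one-to-one and onto; the fully fractional heat operator $(\partial_t-\Delta)^\alpha:Y^p_\alpha\to X^p$ is defined as the inverse of $J_\alpha:X^p\to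 Y^p_\alpha$. Likewise $(\partial_t-\Delta)^\beta:Y^q_\beta\to X^q$ is the inverse of $J_\beta:X^q\to Y^q_\beta$. *)

(* Defs.v *)
From HB Require Import structures.
From mathcomp Require Import all_boot all_order all_algebra.
From mathcomp Require Import all_classical all_reals all_analysis.
Set Implicit Arguments.
Unset Strict Implicit.
Unset Printing Implicit Defensive.
Import Order.TTheory GRing.Theory Num.Theory.
Import numFieldNormedType.Exports.
Local Open Scope classical_set_scope.
Local Open Scope ring_scope.

(* R^n is [euclid R n], with the sigma-algebra generated by the coordinates.
   [measurableTypeR R] is R itself, carrying the Borel sigma-algebra on which
   [lebesgue_measure] is defined. *)
Notation euclid R n := (n.-tuple (measurableTypeR R)).
Notation spacetime R n := (euclid R n * measurableTypeR R)%type.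

(* The product instance of the library is only inferred for subprobabilities. *)
Lemma product_measure_sigma_finite d1 d2 (T1 : measurableType d1)
    (T2 : measurableType d2) (R : realType)
    (m1 : {sigma_finite_measure set T1 -> \bar R})
    (m2 : {sigma_finite_measure set T2 -> \bar R}) :
  sigma_finite [set: T1 * T2] (m1 \x m2)%E.
Proof.
have /sigma_finiteP[F [TF ndF Foo]] := sigma_finiteT m1.
have /sigma_finiteP[G [TG ndG Goo]] := sigma_finiteT m2.
exists (fun n => F n `*` G n).
  rewrite -setXTT TF TG predeqE => -[x y]; split.
    move=> [/= [n _ Fnx] [k _ Gky]]; exists (maxn n k) => //; split.
    - by move: x Fnx; exact/subsetPset/ndF/leq_maxl.
    - by move: y Gky; exact/subsetPset/ndG/leq_maxr.
  by move=> [n _ []/= ? ?]; split; exists n.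
move=> k; have [? ?] := Foo k; have [? ?] := Goo k.
split; first exact: measurableX.
by rewrite product_measure1E// lte_mul_pinfty// ge0_fin_numE.
Qed.

Section lebesgue_euclid.
Context {R : realType}.

Definition euclid_cons n (z : measurableTypeR R * euclid R n) :
  euclid R n.+1 := [tuple of z.1 :: z.2].

Lemma measurable_euclid_cons n :
  measurable_fun [set: measurableTypeR R * euclid R n] (@euclid_cons n).
Proof. by apply: measurable_cons; [exact: measurable_fst|exact: measurable_snd]. Qed.

Section succ.
Variables (n : nat) (mu : {sigma_finite_measure set (euclid R n) -> \bar R}).

Definition lebesgue_euclidS : set (euclid R n.+1) -> \bar R :=
  pushforward (lebesgue_measure \x mu)%E (@euclid_cons n).

Let nu : {measure set (euclid R n.+1) -> \bar R} :=
  measure_function_pushforward__canonical__measure_function_Measure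
    (lebesgue_measure \x mu)%E (@measurable_euclid_cons n).

HB.instance Definition _ := isMeasure.Build _ _ _ lebesgue_euclidS
  (measure0 nu) (measure_ge0 nu) (@measure_semi_sigma_additive _ _ _ nu).

Let lebesgue_euclidS_sigma_finite : sigma_finite setT lebesgue_euclidS.
Proof.
have [F FT Foo] := product_measure_sigma_finite (@lebesgue_measure R) mu.
pose g (x : euclid R n.+1) := (thead x, [tuple of behead x]).
have mg : measurable_fun setT g.
  by apply/measurable_fun_pairP; split;
    [exact: measurable_tnth|exact: measurable_behead].
have gK z : g (euclid_cons z) = z.
  by case: z => a x; rewrite /g /euclid_cons theadE; congr pair; exact: val_inj.
exists (fun k => g @^-1` F k).
  by rewrite -preimage_bigcup -FT preimage_setT.
move=> k; have [mF ltF] := Foo k; split.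
  by rewrite -[X in measurable X]setTI; exact: mg.
rewrite /lebesgue_euclidS /pushforward -comp_preimage.
by rewrite (_ : g \o _ = id) // funeqE => z; exact: gK.
Qed.

HB.instance Definition _ :=
  Measure_isSigmaFinite.Build _ _ _ lebesgue_euclidS
    lebesgue_euclidS_sigma_finite.
End succ.

Fixpoint lebesgue_euclid n : {sigma_finite_measure set (euclid R n) -> \bar R} :=
  if n is m.+1 then lebesgue_euclidS (lebesgue_euclid m) else dirac [tuple].

End lebesgue_euclid.

Lemma lebesgue_euclid_box (R : realType) n (A : 'I_n -> set (measurableTypeR R)) :
  (forall i, measurable (A i)) ->
  lebesgue_euclid n [set x | forall i, A i (tnth x i)] =
  (\prod_(i < n) lebesgue_measure (A i))%E.
Proof.
elim: n A => [|n IH] A mA.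
  rewrite big_ord0 /= /dirac indicE mem_set//.
  by case.
rewrite big_ord_recl /= /lebesgue_euclidS /pushforward.
rewrite -(IH (fun i => A (lift ord0 i)))//.
rewrite -product_measure1E//; last first.
  rewrite (_ : mkset _ = \bigcap_(i in [set: 'I_n])
      ((fun x : euclid R n => tnth x i) @^-1` A (lift ord0 i))).
    apply: fin_bigcap_measurable => [|i _]; first exact: finite_finset.
     rewrite -[X in measurable X]setTI.
    exact: measurable_tnth.
  by apply/seteqP; split => [x Ax i _|x Ax i]; exact: Ax.
congr product_measure1; apply/seteqP; split => -[a x]/=.
  move=> Ax; split; first by have := Ax ord0; rewrite tnth0.
  by move=> i; have := Ax (lift ord0 i); rewrite tnthS.
move=> [Aa Ax] i; case: (unliftP ord0 i) => [j ->|->].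
  by rewrite tnthS; exact: Ax.
by rewrite tnth0.
Qed.

Section heat.
Context {R : realType} {n : nat}.
Implicit Types (p alpha : R) (r : \bar R) (f u : spacetime R n -> R).

Definition spacetime_measure : set (spacetime R n) -> \bar R :=
  (lebesgue_euclid n \x lebesgue_measure)%E.

HB.instance Definition _ := Measure.on spacetime_measure.
HB.instance Definition _ := Measure_isSigmaFinite.Build _ _ _ spacetime_measure
  (product_measure_sigma_finite (lebesgue_euclid n) lebesgue_measure).

Definition euclid_sub (x y : euclid R n) : euclid R n :=
  [tuple (tnth x i : R) - tnth y i | i < n].

Definition euclid_norm (x : euclid R n) : R :=
  Num.sqrt (\sum_(i < n) (tnth x i : R) ^+ 2).

Definition Gamma (a : R) : R :=
  Rintegral lebesgue_measure `]0, +oo[ (fun s => s `^ (a - 1) * expR (- s)).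

Definition heat_kernel alpha (x : euclid R n) (t : R) : R :=
  if 0 < t then
    t `^ (alpha - 1) / Gamma alpha * ((4 * pi * t) `^ (n%:R / 2))^-1 *
      expR (- (euclid_norm x ^+ 2 / (4 * t)))
  else 0.

(* Extended-real valued, since for f in X^p the integral may still diverge on a
   null set. *)
Definition J_op alpha f (z : spacetime R n) : \bar R :=
  (\int[spacetime_measure]_(w in [set w : spacetime R n | (w.2 < z.2 :> R)%R])
    (heat_kernel alpha (euclid_sub z.1 w.1) ((z.2 : R) - w.2) * f w)%:E)%E.

(* The L^r norm over [D]: extending by 0 outside [D] affects neither the integral
   nor the essential supremum of |f|. *)
Definition Lnorm_on (D : set (spacetime R n)) r f : \bar R :=
  'N[spacetime_measure]_r[(EFin \o f) \_ D]%E.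

(* Elements of X^p, Y^p_alpha are functions rather than classes modulo a.e.
   equality; all the predicates below are invariant under a.e. equality of
   measurable functions. *)
Definition X_space p : set (spacetime R n -> R) :=
  [set f | measurable_fun setT f /\
    forall T : R, (Lnorm_on [set z | (z.2 < T :> R)%R] p%:E f < +oo)%E].

Definition J_ae_eq alpha f u :=
  {ae spacetime_measure, forall z, (u z)%:E = J_op alpha f z}.

Definition Y_space p alpha : set (spacetime R n -> R) :=
  [set u | measurable_fun setT u /\ exists2 f, X_space p f & J_ae_eq alpha f u].

(* [frac_heat p alpha u f] stands for f = (d_t - Laplacian)^alpha u, the
   operator Y^p_alpha -> X^p being given by its graph: as the inverse of
   J_alpha : X^p -> Y^p_alpha, it maps u to the f in X^p with J_alpha f = u. *)
Definition frac_heat p alpha u f :=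
  [/\ Y_space p alpha u, X_space p f & J_ae_eq alpha f u].

Definition parabolic_region (t : R) : set (spacetime R n) :=
  [set z | euclid_norm z.1 < Num.sqrt t /\ t < z.2 < 2 * t].

Definition admissible_order p alpha :=
  (1 < p /\ 0 < alpha < (n%:R + 2) / (2 * p)) \/
  (p = 1 /\ 0 < alpha <= (n%:R + 2) / (2 * p)).

End heat.

Arguments admissible_order {R} n p alpha.

(* Main.v *)
Require Import Defs.
From mathcomp Require Import all_boot all_order all_algebra.
From mathcomp Require Import all_classical all_reals all_analysis.
From mathcomp Require Import measurable_realfun ess_sup_inf ring lra.
Import Order.TTheory GRing.Theory Num.Theory.
Import numFieldNormedType.Exports.
Local Open Scope classical_set_scope.
Local Open Scope ring_scope.

(* Both (d_t - Delta)^alpha u and (d_t - Delta)^beta v are taken of the form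
   (t - T_j)^(-a), resp. (t - T_j)^(-b), on the paraboloids |x_i|^2 < t - T_j,
   restricted to short time intervals after the times T_j = t_j = 2^-(j+1).  A
   potential of order beta gains the power beta: J_beta of the second profile is
   at least c (t - T_j)^(beta - b) on the paraboloid, because a parabolic box of
   comparable size lies at comparable distance in the past.  Hence the
   inequalities hold near the singularities as soon as a < lambda (b - beta) and
   b < sigma (a - alpha), short intervals absorbing the constants.  With
   D = (n + 2) / 2, the profile is in L^p iff p a < D, and its L^r norm is
   infinite near every T_j if r a > D; the hypotheses on sigma, lambda, r, s are
   what makes all these constraints on (a, b) compatible.  Integrals are estimated
   by covering with dyadic parabolic boxes. *)

(** * Integral bounds from countable covers, and elementary inequalities for powers *)

(** At each point one [g k] dominates [f], hence so does their sum; the sum is integrated term by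
    term and bounded by a geometric series. *)
Lemma integral_le_geometric_cover d (T : measurableType d) (R : realType)
    (mu : {measure set T -> \bar R}) (D : set T) (f : T -> \bar R)
    (g : nat -> T -> \bar R) (C th : R) :
  measurable D -> measurable_fun D f -> (forall x, D x -> (0 <= f x)%E) ->
  (forall k, measurable_fun D (g k)) ->
  (forall k x, D x -> (0 <= g k x)%E) ->
  (forall x, D x -> exists k, (f x <= g k x)%E) ->
  (forall k, (\int[mu]_(x in D) g k x <= (C * th ^+ k)%:E)%E) ->
  0 < th < 1 ->
  (\int[mu]_(x in D) f x <= (C / (1 - th))%:E)%E.
Proof.
move=> mD mf f0 mg g0 fg intg /andP[th0 th1].
have C0 : 0 <= C.
  have := intg 0%N; rewrite expr0 mulr1 => h.
  by rewrite -lee_fin (le_trans _ h)// integral_ge0// => x Dx; exact: g0.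
apply: (@le_trans _ _ (\int[mu]_(x in D) \sum_(0 <= k <oo) g k x)%E).
  apply: ge0_le_integral => //.
    by apply: ge0_emeasurable_sum => // k x Dx _; exact: g0.
  move=> x Dx; have [k fk] := fg x Dx.
  apply: (le_trans fk); apply: le_trans; last first.
    by apply: (@nneseries_lim_ge _ _ _ 0%N k.+1) => i _ _; exact: g0.
  rewrite big_nat_recr//= leeDr// sume_ge0// => i _; exact: g0.
rewrite integral_nneseries//.
apply: lime_le; first by apply: is_cvg_nneseries => k _ _; apply: integral_ge0 => x; exact: g0.
apply: nearW => n.
apply: (@le_trans _ _ (\sum_(0 <= k < n) (C * th ^+ k)%:E)%E).
  by apply: lee_sum => k _.
rewrite sumEFin lee_fin.
by apply: (geometric_le_lim n C0 th0); rewrite ger0_norm// ltW.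
Qed.

(** The previous bound for [g k] equal to [c k] times the indicator of [A k]. The sets may overlap
    and may stick out of [D]. *)
Lemma integral_le_weighted_cover d (T : measurableType d) (R : realType)
    (mu : {measure set T -> \bar R}) (D : set T) (f : T -> \bar R)
    (A : nat -> set T) (c : nat -> R) (C th : R) :
  measurable D -> measurable_fun D f -> (forall x, D x -> (0 <= f x)%E) ->
  (forall k, measurable (A k)) -> (forall k, 0 <= c k) ->
  (forall x, D x -> exists2 k, A k x & (f x <= (c k)%:E)%E) ->
  (forall k, ((c k)%:E * mu (A k) <= (C * th ^+ k)%:E)%E) ->
  0 < th < 1 ->
  (\int[mu]_(x in D) f x <= (C / (1 - th))%:E)%E.
Proof.
move=> mD mf f0 mA c0 fA intA th01.
pose g k x := ((c k)%:E * (\1_(A k) x)%:E)%E.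
have mI k : measurable_fun D (fun x => (\1_(A k) x : R)%:E).
  by apply/measurable_EFinP; exact: measurable_indic.
apply: (@integral_le_geometric_cover _ _ _ _ _ _ g) => //.
- by move=> k; apply: measurable_funeM.
- by move=> k x _; rewrite mule_ge0// lee_fin.
- move=> x Dx; have [k Akx fk] := fA x Dx; exists k.
  by rewrite /g indicE mem_set// mule1.
- move=> k; apply: le_trans (intA k).
  rewrite ge0_integralZl_EFin//.
  rewrite integral_indic// lee_wpmul2l ?lee_fin//.
  by apply: le_measure; rewrite ?inE//; exact: measurableI.
Qed.

Lemma expr_lt_exists {R : realType} (th y : R) :
  0 < th < 1 -> 0 < y -> exists k : nat, th ^+ k < y.
Proof.
move=> /andP[th0 th1] y0.
have /cvgrPdist_lt/(_ _ y0)[k _ /(_ k (leqnn k))] : (th ^+ n @[n --> \oo] --> 0).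
  by apply: cvg_expr; rewrite ger0_norm// ltW.
by rewrite sub0r normrN ger0_norm ?exprn_ge0 ?ltW// => h; exists k.
Qed.

Lemma geometric_scale {R : realType} (th y : R) :
  0 < th < 1 -> 0 < y <= 1 -> exists k : nat, th ^+ k.+1 < y <= th ^+ k.
Proof.
move=> th01 /andP[y0 y1].
case: (ex_minnP (expr_lt_exists _ _ th01 y0)) => -[|k] hk kmin.
  by move: hk; rewrite expr0 ltNge y1.
exists k; rewrite hk leNgt; apply/negP => /kmin.
by rewrite ltnn.
Qed.

Lemma lebesgue_measure_bounded_itv {R : realType} (a b : R) (x y : bool) :
  a <= b ->
  lebesgue_measure ([set` Interval (BSide x a) (BSide y b)] : set R) =
  (b - a)%:E.
Proof.
rewrite lebesgue_measure_itv/= lte_fin -EFinD; case: ltgtP => // -> _.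
by rewrite subrr.
Qed.

Lemma le_powR {R : realType} (r x y : R) :
  0 <= r -> 0 <= x -> x <= y -> x `^ r <= y `^ r.
Proof.
by move=> r0 x0 xy; apply: ge0_ler_powR; rewrite ?nnegrE// (le_trans x0).
Qed.

Lemma le_powRN {R : realType} (r x y : R) :
  0 <= r -> 0 < x -> x <= y -> y `^ (- r) <= x `^ (- r).
Proof.
move=> r0 x0 xy; have y0 : 0 < y by apply: lt_le_trans xy.
by rewrite !powRN lef_pV2 ?posrE ?powR_gt0// le_powR// ltW.
Qed.

(** Raise [1 + x <= expR x] at [x = y / (c + 1)] to the power [c] and use [c / (c + 1) <= 1].
    Dividing by [c + 1] rather than [c] includes the case [c = 0]. *)
Lemma powR_le_expR {R : realType} (c y : R) : 0 <= c -> 0 <= y ->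
  y `^ c <= (c + 1) `^ c * expR y.
Proof.
move=> c0 y0.
have c1 : 0 < c + 1 by rewrite ltr_pwDr.
have -> : y `^ c = (c + 1) `^ c * (y / (c + 1)) `^ c.
  rewrite -powRM ?divr_ge0 ?(ltW c1)//.
  by rewrite [(c + 1) * _]mulrC divfK// gt_eqF.
apply: ler_wpM2l; first exact: powR_ge0.
apply: (@le_trans _ _ (expR (y / (c + 1)) `^ c)).
  apply: le_powR; rewrite ?divr_ge0 ?(ltW c1)//.
  have := expR_ge1Dx (y / (c + 1)); lra.
rewrite -expRM ler_expR -mulrA ler_piMr//.
rewrite mulrC ler_pdivrMr// mul1r; lra.
Qed.

(** * The Gamma function *)

Section Gamma.
Variable R : realType.
Implicit Types a s : R.

Let gam a s : \bar R := (s `^ (a - 1) * expR (- s))%:E.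

Let mgam a (D : set R) : measurable_fun D (gam a).
Proof.
apply/measurable_EFinP/measurable_funM.
  exact: measurable_funTS (measurable_powR _).
apply: measurable_funTS; apply: measurableT_comp => //.
Qed.

Let gam_ge0 a s : (0 <= gam a s)%E.
Proof. by rewrite lee_fin mulr_ge0 ?powR_ge0 ?expR_ge0. Qed.

(** The dyadic interval below 2^-k has length 2^-(k+1) and contributes at most (2^-a)^k. *)
Lemma Gamma_near0 a : 0 < a ->
  (\int[lebesgue_measure]_(s in `]0%R, 1%R]) gam a s < +oo)%E.
Proof.
move=> a0.
have h0 : 0 < (2^-1 : R) by lra.
have h1 : (2^-1 : R) < 1 by lra.
have hk0 k : 0 < (2^-1 : R) ^+ k by rewrite exprn_gt0.
apply: le_lt_trans (ltry _).
apply: (@integral_le_weighted_cover _ (measurableTypeR R) R lebesgue_measure _ (gam a)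
  (fun k => `](2^-1) ^+ k.+1, (2^-1) ^+ k]%classic)
  (fun k => ((2^-1) ^+ k) `^ a / (2^-1) ^+ k.+1) 1 (2^-1 `^ a)) => //.
- exact: mgam.
- move=> s /=; rewrite in_itv/= => /andP[s0 s1].
  have [||k /andP[k1 k2]] := @geometric_scale R 2^-1 s; first exact/andP.
    exact/andP.
  exists k; first by rewrite /= in_itv/= k1 k2.
  rewrite lee_fin -[leRHS]mulr1 ler_pM ?powR_ge0 ?expR_ge0//; last first.
    by rewrite -expR0 ler_expR oppr_le0 ltW.
  (* The power is split as s^a / s, whose factors are monotone whatever the sign of a - 1. *)
  rewrite powRB; last by apply/implyP => _; rewrite gt_eqF.
  rewrite powRr1 ?(ltW s0)// ler_pM ?powR_ge0 ?invr_ge0 ?(ltW s0)//.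
    by apply: le_powR => //; exact: ltW.
  by rewrite lef_pV2 ?posrE// ltW.
- move=> k; rewrite [X in (_ * X)%E](_ : _ = ((2^-1) ^+ k - (2^-1) ^+ k.+1)%:E); last first.
    by apply: lebesgue_measure_bounded_itv; rewrite exprS ger_pMl// ltW.
  rewrite -EFinM lee_fin mul1r.
  rewrite -powR_mulrn ?powR_ge0// -powRrM [a * _]mulrC powRrM powR_mulrn ?(ltW h0)//.
  rewrite -mulrA ger_pMr ?powR_gt0// exprS.
  by have := hk0 k; set y := _ ^+ k => y0; rewrite mulrC ler_pdivrMr ?mulr_gt0//; lra.
- rewrite powR_gt0//= -[ltRHS](congr1 (@^~ a) (@powR1 R)).
  by apply: gt0_ltr_powR => //; rewrite nnegrE// ltW.
Qed.

(** Since s^(a+1) e^-s is bounded, the integrand is at most C / s^2, and the dyadic interval above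
    2^k contributes at most C 2^-k. *)
Lemma Gamma_near_pinfty a : 0 < a ->
  (\int[lebesgue_measure]_(s in `]1%R, +oo[) gam a s < +oo)%E.
Proof.
move=> a0.
have hk0 k : 0 < (2 : R) ^+ k by rewrite exprn_gt0.
apply: le_lt_trans (ltry _).
set C := (a + 1 + 1) `^ (a + 1).
apply: (@integral_le_weighted_cover _ (measurableTypeR R) R lebesgue_measure _ (gam a)
  (fun k => `[2 ^+ k, 2 ^+ k.+1]%classic)
  (fun k => C / (2 ^+ k) ^+ 2) C 2^-1) => //.
- exact: mgam.
- by move=> k; rewrite divr_ge0 ?powR_ge0 ?exprn_ge0.
- move=> s /=; rewrite in_itv/= andbT => s1.
  have s0 : 0 < s by lra.
  have [||k] := @geometric_scale R 2^-1 s^-1; first lra.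
    by rewrite invr_gt0 s0/= invf_le1// ltW.
  rewrite !exprVn ltf_pV2 ?posrE ?exprn_gt0// lef_pV2 ?posrE ?exprn_gt0// => /andP[k1 k2].
  exists k; first by rewrite /= in_itv/= k2 ltW.
  rewrite lee_fin.
  have -> : s `^ (a - 1) = s `^ (a + 1) / s ^+ 2.
    rewrite -powR_mulrn ?(ltW s0)// -powRB; last by apply/implyP => _; rewrite gt_eqF.
    by congr powR; lra.
  have /(ler_wpM2r (expR_ge0 (- s))) := @powR_le_expR R (a + 1) s ltac:(lra) (ltW s0).
  rewrite /= -/C -[C * _ * _]mulrA -expRD subrr expR0 mulr1 => h.
  rewrite mulrAC ler_pM ?mulr_ge0 ?powR_ge0 ?expR_ge0 ?invr_ge0 ?exprn_ge0//.
    exact: ltW.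
  by rewrite lef_pV2 ?posrE ?exprn_gt0// ler_pXn2r ?nnegrE// ltW.
- move=> k; rewrite [X in (_ * X)%E](_ : _ = (2 ^+ k.+1 - 2 ^+ k)%:E); last first.
    apply: lebesgue_measure_bounded_itv; rewrite exprS.
    by have := hk0 k; set y := _ ^+ k; lra.
  rewrite -EFinM lee_fin exprVn [2 ^+ k.+1]exprS -mulrA; apply: ler_wpM2l; first exact: powR_ge0.
  have := hk0 k; set y := _ ^+ k => y0.
  have -> : 2 * y - y = y by lra.
  by rewrite expr2 invfM -mulrA mulVf ?mulr1// gt_eqF.
- by apply/andP; split; lra.
Qed.

(** [Gamma] is the [fine] part of an integral and would be 0 if that integral were +oo, so
    finiteness is proved along with positivity. The latter comes from [1, 2], where s^a >= 1 and 1/s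
    >= 1/2. *)
Lemma Gamma_gt0 a : 0 < a -> 0 < Gamma a.
Proof.
move=> a0; rewrite /Gamma /Rintegral fine_gt0//.
rewrite -[X in (_ < X < _)%E]/(\int[lebesgue_measure]_(s in `]0%R, +oo[) gam a s)%E.
apply/andP; split.
  have c0 s : 1 <= s <= 2 -> 2^-1 * expR (- 2) <= s `^ (a - 1) * expR (- s).
    move=> /andP[s1 s2]; rewrite ler_pM ?expR_ge0 ?invr_ge0// ?ler_expR ?lerN2//.
    rewrite powRB; last by apply/implyP => _; rewrite gt_eqF// (lt_le_trans _ s1).
    rewrite powRr1 ?(le_trans _ s1)//.
    rewrite -[leLHS]mul1r ler_pM//.
      by rewrite -[leLHS](powRr0 s) ler_powR// ltW.
    by rewrite lef_pV2 ?posrE// (lt_le_trans _ s1).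
  apply: (@lt_le_trans _ _ (\int[lebesgue_measure]_(s in `[1%R, 2%R]) (2^-1 * expR (- 2))%:E)%E).
    rewrite (@integral_cst _ _ _ _ _ _ (2^-1 * expR (- 2))%:E)//.
    rewrite [X in (_ * X)%E](_ : _ = (2 - 1)%:E); last first.
      by apply: lebesgue_measure_bounded_itv; rewrite ler1n.
    by rewrite -EFinM lte_fin !mulr_gt0 ?expR_gt0 ?invr_gt0//; lra.
  apply: (@le_trans _ _ (\int[lebesgue_measure]_(s in `[1%R, 2%R]) gam a s)%E).
    apply: ge0_le_integral => //; exact (mgam a _).
  apply: ge0_subset_integral => //; first exact (mgam a _).
  by move=> s /=; rewrite !in_itv/= andbT => /andP[s1 _]; rewrite (lt_le_trans _ s1).
rewrite (_ : `]0%R, +oo[%classic = `]0%R, 1%R]%classic `|` `]1%R, +oo[%classic :> set R); last first.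
  apply/seteqP; split => s /=; rewrite !in_itv/= !andbT.
    by move=> s0; rewrite s0/=; case: (leP s 1); [left|right].
  by move=> [/andP[]//|/(lt_trans _) ->].
rewrite ge0_integral_setU//; [|exact (mgam a _)|].
  by rewrite lte_add_pinfty ?Gamma_near0 ?Gamma_near_pinfty.
rewrite disj_set2E; apply/eqP/seteqP; split => // s /=.
by rewrite !in_itv/= andbT => -[/andP[_ /le_lt_trans h] /h]; rewrite ltxx.
Qed.

End Gamma.

(** * Heat kernel bounds on parabolic boxes *)

Section box.
Context {R : realType} {n : nat}.
Implicit Types (x y : euclid R n) (rho a b : R).

(** Cubes rather than balls in space, so that the measure is a product of interval lengths. *)
Definition box y rho a b : set (spacetime R n) :=
  [set w | (forall i, `|(tnth w.1 i : R) - tnth y i| < rho) /\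
           a < (w.2 : R) <= b].

Let boxE y rho a b : box y rho a b =
  [set x | forall i, `](tnth y i : R) - rho, (tnth y i : R) + rho[%classic (tnth x i)]
    `*` `]a, b]%classic.
Proof.
apply/seteqP; split => -[x t] [/= xy tab]; split => //= i; have := xy i;
  rewrite /= ?in_itv/= -?ltr_distl// distrC//.
Qed.

Let measurable_cube y rho : measurable
  [set x : euclid R n |
    forall i, `](tnth y i : R) - rho, (tnth y i : R) + rho[%classic (tnth x i)].
Proof.
rewrite (_ : mkset _ = \bigcap_(i in [set: 'I_n])
    ((fun x : euclid R n => tnth x i) @^-1`
       `](tnth y i : R) - rho, (tnth y i : R) + rho[%classic)); last first.
  by apply/seteqP; split => [x Ax i _|x Ax i]; exact: Ax.
apply: fin_bigcap_measurable => [|i _]; first exact: finite_finset.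
rewrite -[X in measurable X]setTI.
exact: measurable_tnth.
Qed.

Lemma measurable_box y rho a b : measurable (box y rho a b).
Proof. by rewrite boxE; apply: measurableX => //; exact: measurable_cube. Qed.

Lemma box_measure y rho a b : 0 <= rho -> a <= b ->
  spacetime_measure (box y rho a b) = ((2 * rho) ^+ n * (b - a))%:E.
Proof.
move=> rho0 ab; rewrite boxE /spacetime_measure product_measure1E//.
rewrite [X in (_ * X)%E](_ : _ = (b - a)%:E); last exact: lebesgue_measure_bounded_itv.
pose A (i : 'I_n) : set (measurableTypeR R) :=
  `](tnth y i : R) - rho, (tnth y i : R) + rho[%classic.
rewrite [X in (X * _)%E](_ : _ = (\prod_(i < n) lebesgue_measure (A i))%E); last first.
  by apply: (@lebesgue_euclid_box _ _ A) => i; exact: measurable_itv.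
rewrite (eq_bigr (fun=> (2 * rho)%:E)); last first.
  move=> i _; rewrite [LHS](_ : _ = ((tnth y i : R) + rho - (tnth y i - rho))%:E).
    by congr EFin; ring.
  by apply: lebesgue_measure_bounded_itv; lra.
by rewrite prodEFin EFinM big_const_ord iter_mulr_1.
Qed.

End box.

Definition heat_constant {R : realType} (n : nat) (alpha : R) : R :=
  (Gamma alpha)^-1 * ((4 * pi) `^ (n%:R / 2))^-1.

Section heat_kernel_bounds.
Context {R : realType} {n : nat}.
Variable alpha : R.
Hypotheses (alpha0 : 0 < alpha) (alphan : alpha <= 1 + n%:R / 2).
Implicit Types (x : euclid R n) (t : R).

(** The kernel carries the factor t^-gam; the bound on [alpha] gives [gam >= 0], so this factor is
    nonincreasing in t. *)
Let gam : R := 1 + n%:R / 2 - alpha.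
Let gam0 : 0 <= gam. Proof. by rewrite /gam subr_ge0. Qed.
Let K := heat_constant n alpha.
Let K0 : 0 < K.
Proof. by rewrite /K /heat_constant mulr_gt0// invr_gt0 ?Gamma_gt0 ?powR_gt0 ?mulr_gt0 ?pi_gt0. Qed.

Lemma heat_kernelE x t : 0 < t -> heat_kernel alpha x t =
  heat_constant n alpha * t `^ (- gam) * expR (- ((\sum_(i < n) (tnth x i : R) ^+ 2) / (4 * t))).
Proof.
move=> t0; rewrite /heat_kernel t0 /euclid_norm sqr_sqrtr; last first.
  by apply: sumr_ge0 => i _; exact: sqr_ge0.
congr (_ * _); rewrite powRM ?mulr_ge0 ?pi_ge0 ?(ltW t0)//.
rewrite (_ : - gam = (alpha - 1) - n%:R / 2); last by rewrite /gam; lra.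
rewrite [t `^ (alpha - 1 - _)]powRB; last by apply/implyP => _; rewrite gt_eqF.
by rewrite /heat_constant invfM; ring.
Qed.

Lemma heat_kernel_ge0 x t : 0 <= heat_kernel alpha x t.
Proof.
case: (ltP 0 t) => t0; last by rewrite /heat_kernel ltNge t0.
by rewrite heat_kernelE// -/K mulr_ge0 ?expR_ge0// mulr_ge0 ?powR_ge0// ltW.
Qed.

(* If t < delta then delta <= |x|^2, and the Gaussian factor compensates the
   negative power of t. *)
Lemma heat_kernel_le : exists2 C : R, 0 <= C & forall delta x t, 0 < delta ->
  delta <= t \/ (exists i, delta <= (tnth x i : R) ^+ 2) ->
  heat_kernel alpha x t <= C * delta `^ (- (1 + n%:R / 2 - alpha)).
Proof.
set M : R := 4 `^ gam * (gam + 1) `^ gam.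
have M0 : 0 <= M by rewrite mulr_ge0 ?powR_ge0.
(* The term 1 serves the case [delta <= t], the term [M] the case where some squared coordinate is
   at least [delta]. *)
exists (K * (1 + M)); first by rewrite mulr_ge0 ?(ltW K0)//; lra.
move=> delta x t d0; rewrite -/gam => h.
have dg0 : 0 <= delta `^ (- gam) by exact: powR_ge0.
have KM : 0 <= K * M by rewrite mulr_ge0// ltW.
case: (ltP 0 t) => t0; last first.
  rewrite /heat_kernel ltNge t0/= mulr_ge0// mulr_ge0 ?(ltW K0)//; lra.
rewrite heat_kernelE// -/K -[K * _ * _]mulrA -[K * _ * _]mulrA ler_pM2l//.
case: h => [dt|[i di]].
  apply: (@le_trans _ _ (delta `^ (- gam) * 1)).
    rewrite ler_pM ?powR_ge0 ?expR_ge0 ?le_powRN//.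
    rewrite -[leRHS]expR0 ler_expR oppr_le0 divr_ge0 ?mulr_ge0 ?(ltW t0)//.
    by apply: sumr_ge0 => i _; exact: sqr_ge0.
  by rewrite mulr1 -[leLHS]mul1r ler_wpM2r//; lra.
apply: (@le_trans _ _ (t `^ (- gam) * expR (- (delta / (4 * t))))).
  rewrite ler_wpM2l ?powR_ge0// ler_expR lerN2 ler_wpM2r ?invr_ge0 ?mulr_ge0 ?(ltW t0)//.
  rewrite (bigD1 i)//= (le_trans di)// lerDl.
  by apply: sumr_ge0 => j _; exact: sqr_ge0.
have y0 : 0 <= delta / (4 * t) by rewrite divr_ge0 ?mulr_ge0 ?(ltW t0) ?(ltW d0).
have := @powR_le_expR R gam (delta / (4 * t)) gam0 y0.
move/(ler_wpM2r (expR_ge0 (- (delta / (4 * t))))).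
rewrite /= -[_ * _ * expR (- _)]mulrA -expRD subrr expR0 mulr1.
move/(ler_wpM2l (mulr_ge0 (powR_ge0 4 gam) dg0)) => /=.
(* t^-gam is rewritten as 4^gam delta^-gam y^gam with y = delta / (4 t), so that the bound on y^gam
   e^-y applies. *)
rewrite (_ : 4 `^ gam * delta `^ (- gam) * ((delta / (4 * t)) `^ gam * expR (- (delta / (4 * t)))) =
  t `^ (- gam) * expR (- (delta / (4 * t)))) ; last first.
  rewrite powRM ?invr_ge0 ?mulr_ge0 ?(ltW t0) ?(ltW d0)//.
  rewrite -[(4 * t)^-1]powR_inv1 ?mulr_ge0 ?(ltW t0)// -powRrM mulN1r.
  rewrite powRM ?(ltW t0)// !powRN; field.
  by rewrite !gt_eqF ?powR_gt0.
move/le_trans; apply.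
rewrite mulrAC -/M.
by rewrite ler_wpM2r//; lra.
Qed.

(** From 4 t >= h and |x|^2 <= 4 n h the Gaussian factor is at least e^(-4n), and t <= h bounds the
    power of t from below. *)
Lemma heat_kernel_ge : exists2 c : R, 0 < c & forall h x t, 0 < h ->
  h / 4 <= t <= h -> (forall i, (tnth x i : R) ^+ 2 <= 4 * h) ->
  c * h `^ (- (1 + n%:R / 2 - alpha)) <= heat_kernel alpha x t.
Proof.
exists (K * expR (- (4 * n%:R))); first by rewrite mulr_gt0 ?expR_gt0.
move=> h x t h0 /andP[ht th] xh; rewrite -/gam.
have t0 : 0 < t by lra.
rewrite heat_kernelE// -/K -[leLHS]mulrA -[leRHS]mulrA ler_pM2l// mulrC ler_pM ?powR_ge0 ?expR_ge0 ?le_powRN//.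
rewrite ler_expR lerN2 ler_pdivrMr ?mulr_gt0//.
apply: (@le_trans _ _ (\sum_(i < n) (4 * h))); first by apply: ler_sum => i _.
rewrite sumr_const card_ord -mulr_natr.
have := ler0n R n; nra.
Qed.

End heat_kernel_bounds.

(** * The fractional heat potential *)

Section potential.
Context {R : realType} {n : nat}.
Variable alpha : R.
Hypotheses (alpha0 : 0 < alpha) (alphan : alpha <= 1 + n%:R / 2).
Implicit Types (z w : spacetime R n) (f : spacetime R n -> R).

(** A function of the pair of points, since joint measurability is what Tonelli's theorem
    requires. *)
Definition potential_kernel (a : R) (zw : spacetime R n * spacetime R n) : R :=
  heat_kernel a (euclid_sub zw.1.1 zw.2.1) ((zw.1.2 : R) - zw.2.2).

Lemma measurable_potential_kernel :
  measurable_fun [set: spacetime R n * spacetime R n] (potential_kernel alpha).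
Proof.
pose tau (zw : spacetime R n * spacetime R n) : R := (zw.1.2 : R) - zw.2.2.
pose N (zw : spacetime R n * spacetime R n) : R :=
  \sum_(i < n) ((tnth zw.1.1 i : R) - tnth zw.2.1 i) ^+ 2.
have mtau : measurable_fun setT tau.
  apply: measurable_funB.
    exact: (measurableT_comp measurable_snd measurable_fst).
  exact: (measurableT_comp measurable_snd measurable_snd).
have mN : measurable_fun setT N.
  apply: measurable_sum => i; apply: measurable_funX.
  apply: measurable_funB.
    apply: (measurableT_comp (measurable_tnth i)).
    exact: (measurableT_comp measurable_fst measurable_fst).
  apply: (measurableT_comp (measurable_tnth i)).
  exact: (measurableT_comp measurable_fst measurable_snd).
(* The quotient in the exponent is written with the power -1, so that measurability of powers covers
   it. *)
rewrite (_ : potential_kernel alpha = fun zw => if 0 < tau zw then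
    heat_constant n alpha * tau zw `^ (- (1 + n%:R / 2 - alpha)) *
    expR (- (N zw * (4 * tau zw) `^ (-1))) else 0); last first.
  apply/funext => zw; rewrite /potential_kernel -/(tau zw).
  case: ifPn => tau0; last by rewrite /heat_kernel (negPf tau0).
  rewrite heat_kernelE// powR_inv1 ?mulr_ge0 ?(ltW tau0)//.
  have -> // : \sum_(i < n) (tnth (euclid_sub zw.1.1 zw.2.1) i : R) ^+ 2 = N zw.
  by apply: eq_bigr => i _; rewrite tnth_mktuple.
apply: measurable_fun_ifT => //; first exact: measurable_fun_ltr.
apply: measurable_funM.
  by apply: measurable_funM => //; exact: (measurableT_comp (measurable_powR _)).
apply: measurableT_comp; first exact: measurable_expR.
apply: measurableT_comp => //; apply: measurable_funM => //.
apply: (measurableT_comp (measurable_powR _)).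
exact: measurable_funM.
Qed.

Lemma potential_kernel_ge0 zw : 0 <= potential_kernel alpha zw.
Proof. exact: heat_kernel_ge0. Qed.

(** The kernel vanishes unless [w.2 < z.2], so integrating over all of space-time changes
    nothing. *)
Lemma J_opE f z :
  J_op alpha f z =
  (\int[spacetime_measure]_w (potential_kernel alpha (z, w) * f w)%:E)%E.
Proof.
rewrite /J_op integral_mkcond; apply: eq_integral => w _.
rewrite /patch; case: ifPn => // /negP wz.
rewrite /potential_kernel /heat_kernel/= ifF ?mul0r//.
by apply/negbTE; apply: contra_notN wz; rewrite subr_gt0 inE.
Qed.

Section nonnegative_density.
Variable f : spacetime R n -> R.
Hypotheses (mf : measurable_fun setT f) (f0 : forall w, 0 <= f w).

Let Kf (zw : spacetime R n * spacetime R n) : \bar R :=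
  (potential_kernel alpha zw * f zw.2)%:E.

Let mKf : measurable_fun setT Kf.
Proof.
apply/measurable_EFinP; apply: measurable_funM.
  exact: measurable_potential_kernel.
exact: (measurableT_comp mf measurable_snd).
Qed.

Let Kf0 zw : (0 <= Kf zw)%E.
Proof. by rewrite lee_fin mulr_ge0// potential_kernel_ge0. Qed.

Lemma J_op_ge0 z : (0 <= J_op alpha f z)%E.
Proof. by rewrite J_opE integral_ge0// => w _; exact: Kf0. Qed.

Lemma measurable_J_op : measurable_fun setT (J_op alpha f).
Proof.
rewrite (_ : J_op alpha f = fubini_F spacetime_measure Kf).
  exact: measurable_fun_fubini_tonelli_F.
by apply/funext => z; rewrite J_opE.
Qed.

End nonnegative_density.

End potential.

(** Expresses the volume of a cube through the time scale r^2, so that the exponents of a parabolic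
    box add up. *)
Lemma expr_powR_half {R : realType} (n : nat) (r : R) : 0 <= r ->
  r ^+ n = (r ^+ 2) `^ (n%:R / 2).
Proof.
move=> r0; rewrite -powR_mulrn// -[r ^+ 2]powR_mulrn// -powRrM.
by congr (powR _ _); field.
Qed.

Definition euclid0 {R : realType} {n : nat} : euclid R n := [tuple (0 : R) | i < n].

Section potential_estimates.
Context {R : realType} {n : nat}.
Variable alpha : R.
Hypotheses (alpha0 : 0 < alpha) (alphan : alpha <= 1 + n%:R / 2).
Implicit Types (z w : spacetime R n).

(* The scales are anchored at the pole w; k = 0 stands for the part of the box at
   parabolic distance at least 1 from w, where the kernel is bounded. *)
Lemma potential_kernel_int_le (M : R) : 0 <= M -> exists2 C : R, 0 <= C &
  forall w, (\int[spacetime_measure]_(z in @box R n euclid0 M (- M) M)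
    (potential_kernel alpha (z, w))%:E <= C%:E)%E.
Proof.
move=> M0.
have [C C0 HC] := heat_kernel_le alpha alpha0 alphan (n := n).
set gam := 1 + n%:R / 2 - alpha in HC.
(* At time scale q = 4^-k the kernel is of order q^-gam and the box has measure of order q^(n/2) q;
   the product is q^alpha. *)
pose th : R := 4^-1 `^ alpha.
have th0 : 0 < th by rewrite powR_gt0.
have th1 : th < 1.
  rewrite -[ltRHS](congr1 (@^~ alpha) (@powR1 R)).
  by apply: gt0_ltr_powR => //; rewrite ?nnegrE//; lra.
pose V : R := (2 * M) ^+ n * (M - - M).
have V0 : 0 <= V by rewrite mulr_ge0 ?exprn_ge0//; lra.
pose D : R := C * 4 `^ gam * 2 ^+ n / th.
have D0 : 0 <= D by rewrite divr_ge0 ?(ltW th0)// mulr_ge0 ?exprn_ge0// mulr_ge0 ?powR_ge0.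
exists ((C * V + D) / (1 - th)).
  apply: divr_ge0; last by rewrite subr_ge0 ltW.
  by apply: addr_ge0 => //; exact: mulr_ge0.
move=> w.
have mk : measurable_fun setT (fun z : spacetime R n => potential_kernel alpha (z, w)).
  apply: (measurableT_comp (measurable_potential_kernel alpha)).
  exact: pair2_measurable.
pose A k := if k is k'.+1 then @box R n w.1 (2^-1 ^+ k') w.2 ((w.2 : R) + 4^-1 ^+ k')
            else @box R n euclid0 M (- M) M.
apply: (@integral_le_weighted_cover _ _ _ _ _ _ A (fun k => C * (4^-1 ^+ k) `^ (- gam))) => //.
- exact: measurable_box.
- apply/measurable_EFinP; apply: measurable_funTS.
  exact: mk.
- by move=> z _; rewrite lee_fin potential_kernel_ge0.
- by case=> [|k]; exact: measurable_box.
- by move=> k; rewrite mulr_ge0 ?powR_ge0.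
- move=> z zB.
  pose tau : R := (z.2 : R) - w.2.
  (* [P k] says that z is outside the box of scale k attached to w. The least such k bounds the
     kernel by C (4^-k)^-gam, while for k > 0 the point z still lies in the box of scale k - 1. *)
  pose P k := ~~ ((tau <= 4^-1 ^+ k) && [forall i, `|(tnth z.1 i : R) - tnth w.1 i| < 2^-1 ^+ k]).
  case: (ltP 0 tau) => tau0; last first.
    exists 0%N => //; rewrite lee_fin /potential_kernel /heat_kernel/= -/tau ltNge tau0/=.
    by rewrite mulr_ge0 ?powR_ge0.
  have exP : exists k, P k.
    have [|k hk] := @expr_lt_exists R 4^-1 tau _ tau0; first by lra.
    by exists k; rewrite /P negb_and -ltNge hk.
  case: (ex_minnP exP) => m Pm mmin; exists m.
    case: m Pm mmin => [//|m] _ mmin.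
    have : ~~ P m by apply/negP => /mmin; rewrite ltnn.
    rewrite negbK => /andP[t1 /forallP t2]; split => [i|/=]; first exact: t2.
    by rewrite /tau in tau0 t1; apply/andP; split; lra.
  rewrite lee_fin; apply: HC; first by rewrite exprn_gt0.
  move: Pm; rewrite /P negb_and -ltNge => /orP[/ltW|]; [by left|].
  rewrite negb_forall => /existsP[i]; rewrite -leNgt => hi; right; exists i.
  rewrite tnth_mktuple -[leRHS]real_normK ?num_real//.
  rewrite (_ : 4^-1 = (2^-1) ^+ 2 :> R); last by field.
  by rewrite exprAC ler_pXn2r ?nnegrE ?exprn_ge0.
- case=> [|k].
    rewrite [X in (_ * X)%E](_ : _ = V%:E); last by apply: box_measure => //; lra.
    rewrite -EFinM lee_fin !expr0 (congr1 (@^~ (- gam)) (@powR1 R)) !mulr1.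
    by rewrite lerDl.
  have q0 : 0 < (4^-1 : R) ^+ k by rewrite exprn_gt0.
  rewrite [X in (_ * X)%E](_ : _ =
    ((2 * 2^-1 ^+ k) ^+ n * ((w.2 : R) + 4^-1 ^+ k - w.2))%:E); last first.
    by apply: box_measure; rewrite ?exprn_ge0// lerDl ltW.
  rewrite -EFinM lee_fin addrAC subrr add0r.
  rewrite [(2 * _) ^+ n]exprMn (@expr_powR_half _ _ (2^-1 ^+ k)) ?exprn_ge0//.
  rewrite -exprM mulnC exprM (_ : 2^-1 ^+ 2 = 4^-1 :> R); last by field.
  set q := 4^-1 ^+ k in q0 *.
  have -> : th ^+ k.+1 = th * q `^ alpha.
    rewrite exprS; congr (_ * _).
    by rewrite -powR_mulrn ?powR_ge0// -powRrM mulrC powRrM powR_mulrn.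
  rewrite [4^-1 ^+ k.+1]exprS -/q powRM ?(ltW q0)//.
  rewrite -[4^-1]powR_inv1// -powRrM mulN1r opprK.
  have -> : C * (4 `^ gam * q `^ (- gam)) * (2 ^+ n * q `^ (n%:R / 2) * q) =
      D * (th * q `^ alpha).
    have -> : q `^ alpha = q `^ (- gam) * q `^ (n%:R / 2) * q.
      rewrite -{4}[q]powRr1 ?(ltW q0)// -!powRD ?(gt_eqF q0) ?implybT//.
      by congr (powR _ _); rewrite /gam; ring.
    by rewrite /D; field; rewrite gt_eqF.
  rewrite ler_wpM2r ?mulr_ge0 ?powR_ge0 ?(ltW th0)//.
  by rewrite lerDr mulr_ge0.
- by rewrite th0 th1.
Qed.

End potential_estimates.

Section potential_finiteness.
Context {R : realType} {n : nat}.
Variable alpha : R.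
Hypotheses (alpha0 : 0 < alpha) (alphan : alpha <= 1 + n%:R / 2).
Implicit Types (z w : spacetime R n).
Variable f : spacetime R n -> R.
Hypotheses (mf : measurable_fun setT f) (f0 : forall w, 0 <= f w).

Lemma spacetime_box_exists z : exists k : nat, box euclid0 k%:R (- k%:R) k%:R z.
Proof.
pose m : R := \sum_(i < n) `|tnth z.1 i : R| + `|z.2 : R| + 1.
have s0 : 0 <= \sum_(i < n) `|tnth z.1 i : R| by exact: sumr_ge0.
have m0 : 0 <= m by rewrite /m; have := normr_ge0 (z.2 : R); lra.
have hm : m < (Num.truncn m).+1%:R by exact: truncnS_gt.
set k := (Num.truncn m).+1 in hm; exists k; split.
  move=> i; rewrite tnth_mktuple subr0 (le_lt_trans _ hm)// /m.
  rewrite (bigD1 i)//= -!addrA lerDl.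
  by rewrite !addr_ge0// sumr_ge0.
have : `|z.2 : R| < k%:R by apply: le_lt_trans hm; rewrite /m; lra.
by rewrite ltr_norml => /andP[-> /ltW ->].
Qed.

(* By Tonelli, the potential is integrable on each bounded box. *)
Lemma J_op_ae_fin : (\int[spacetime_measure]_w (f w)%:E < +oo)%E ->
  {ae spacetime_measure, forall z, J_op alpha f z \is a fin_num}.
Proof.
move=> intf.
(* Countably many boxes exhaust space-time, so it suffices to have finiteness almost everywhere on
   each. *)
suff H (k : nat) : {ae spacetime_measure, forall z,
    box euclid0 k%:R (- k%:R) k%:R z -> J_op alpha f z \is a fin_num}.
  have := ae_foralln H; apply: filterS => z hz.
  by have [k /hz] := spacetime_box_exists z.
apply: integrable_ae; first exact: measurable_box.
have mJ : measurable_fun setT (J_op alpha f) by exact: measurable_J_op.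
have J0 z : (0 <= J_op alpha f z)%E by exact: J_op_ge0.
apply/integrableP; split; first exact: measurable_funTS.
under eq_integral => z _ do rewrite gee0_abs//.
set B := box _ _ _ _.
have mB : measurable B by exact: measurable_box.
have [C C0 HC] := potential_kernel_int_le alpha alpha0 alphan k%:R (ler0n R k) (n := n).
(* The indicator moves the restriction to the box into the integrand, so that both integrals run
   over the whole space when exchanged. *)
pose F (zw : spacetime R n * spacetime R n) : \bar R :=
  (\1_B zw.1 * (potential_kernel alpha zw * f zw.2))%:E.
have mF : measurable_fun setT F.
  apply/measurable_EFinP; apply: measurable_funM.
    exact: (measurableT_comp (measurable_indic mB) measurable_fst).
  apply: measurable_funM; first exact: measurable_potential_kernel.
  exact: (measurableT_comp mf measurable_snd).
have pk0 zw : 0 <= potential_kernel alpha zw :> R.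
  exact: potential_kernel_ge0.
have F0 zw : (0 <= F zw)%E by rewrite lee_fin !mulr_ge0.
have mk w : measurable_fun setT
    (fun z : spacetime R n => (potential_kernel alpha (z, w))%:E).
  apply/measurable_EFinP/(measurableT_comp (measurable_potential_kernel alpha)).
  exact: pair2_measurable.
have -> : (\int[spacetime_measure]_(z in B) J_op alpha f z =
  \int[spacetime_measure]_z \int[spacetime_measure]_w F (z, w))%E.
  rewrite integral_mkcond; apply: eq_integral => z _; rewrite /patch /F/=.
  case: ifPn => zB.
    rewrite J_opE; apply: eq_integral => w _.
    by rewrite indicE zB mul1r.
  rewrite integral0_eq// => w _.
  by rewrite indicE (negPf zB) mul0r.
rewrite fubini_tonelli//.
apply: (@le_lt_trans _ _ (\int[spacetime_measure]_w (C%:E * (f w)%:E))%E); last first.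
  rewrite ge0_integralZl_EFin//; [|by move=> w _; rewrite lee_fin|exact/measurable_EFinP].
  by rewrite lte_mul_pinfty.
have mG : measurable_fun setT (fun w => \int[spacetime_measure]_z F (z, w))%E.
  exact: measurable_fun_fubini_tonelli_G.
apply: ge0_le_integral => //.
- by move=> w _; exact: integral_ge0.
- by apply: measurable_funeM; exact/measurable_EFinP.
move=> w _; apply: (@le_trans _ _
  ((f w)%:E * \int[spacetime_measure]_(z in B) (potential_kernel alpha (z, w))%:E)%E).
  rewrite -ge0_integralZl_EFin//; last 2 first.
  - by move=> z _; rewrite lee_fin.
  - by apply: measurable_funTS; exact: mk.
  rewrite [leRHS]integral_mkcond; apply: ge0_le_integral => //.
  - apply: (measurableT_comp mF); exact: pair2_measurable.
  - apply/(measurable_restrictT _ mB)/measurable_funTS.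
    exact: measurable_funeM (mk w).
  - move=> z _; rewrite /F /patch /= indicE.
    by case: ifPn => zB; rewrite ?mul1r ?mul0r// mulrC.
by rewrite muleC lee_wpmul2r// lee_fin.
Qed.

End potential_finiteness.

Section potential_lower_bound.
Context {R : realType} {n : nat}.
Variable alpha : R.
Hypotheses (alpha0 : 0 < alpha) (alphan : alpha <= 1 + n%:R / 2).

(* Only a box at times between z.2 - 3h/4 and z.2 - h/2 is used, where the kernel is
   comparable to h^(alpha - 1 - n/2). *)
Lemma J_op_ge : exists2 c : R, 0 < c & forall (f : spacetime R n -> R)
  (z : spacetime R n) (h m : R),
  measurable_fun setT f -> (forall w, 0 <= f w) -> 0 < h -> 0 <= m ->
  (forall i, (tnth z.1 i : R) ^+ 2 <= h) ->
  (forall w, box euclid0 (Num.sqrt h / 2) ((z.2 : R) - 3 / 4 * h) ((z.2 : R) - h / 2) w ->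
    m <= f w) ->
  ((c * m * h `^ alpha)%:E <= J_op alpha f z)%E.
Proof.
have [c c0 Hc] := heat_kernel_ge alpha alpha0 alphan (n := n).
(* The box has height h/4 in time, and its base is a cube of volume h^(n/2). *)
exists (c / 4); first by rewrite divr_gt0.
move=> f z h m mf f0 h0 m0 zh fm.
set B := box _ _ _ _ in fm.
have mB : measurable B by exact: measurable_box.
have sh0 : 0 <= Num.sqrt h by exact: sqrtr_ge0.
have sh2 : Num.sqrt h ^+ 2 = h by rewrite sqr_sqrtr// ltW.
set gam := 1 + n%:R / 2 - alpha in Hc.
have mk : measurable_fun setT (fun w => (potential_kernel alpha (z, w) * f w)%:E).
  apply/measurable_EFinP; apply: measurable_funM => //.
  apply: (measurableT_comp (measurable_potential_kernel alpha)).
  exact: pair1_measurable.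
have k0 w : (0 <= (potential_kernel alpha (z, w) * f w)%:E)%E.
  by rewrite lee_fin mulr_ge0// potential_kernel_ge0.
rewrite J_opE; apply: (@le_trans _ _ (\int[spacetime_measure]_(w in B)
    (potential_kernel alpha (z, w) * f w)%:E)%E); last first.
  exact: ge0_subset_integral.
apply: (@le_trans _ _ (\int[spacetime_measure]_(w in B) (c * h `^ (- gam) * m)%:E)%E).
  rewrite (@integral_cst _ _ _ _ _ mB (c * h `^ (- gam) * m)%:E).
  rewrite [X in (_ * X)%E](_ : _ = ((2 * (Num.sqrt h / 2)) ^+ n *
     ((z.2 : R) - h / 2 - ((z.2 : R) - 3 / 4 * h)))%:E); last first.
    by apply: box_measure; [rewrite divr_ge0|lra].
  rewrite -EFinM lee_fin [2 * _]mulrC divfK ?pnatr_eq0//.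
  rewrite expr_powR_half// sh2.
  have -> : h `^ alpha = h `^ (- gam) * h `^ (n%:R / 2) * h.
    rewrite -{4}[h]powRr1 ?(ltW h0)// -!powRD ?(gt_eqF h0) ?implybT//.
    by congr (powR _ _); rewrite /gam; ring.
  by rewrite le_eqVlt; apply/orP; left; apply/eqP; field.
apply: ge0_le_integral => //.
- by move=> w _; rewrite lee_fin !mulr_ge0 ?powR_ge0// ltW.
- exact: measurable_funTS.
move=> w Bw; have [wx /andP[wt1 wt2]] := Bw.
rewrite lee_fin ler_pM ?fm ?mulr_ge0 ?powR_ge0 ?(ltW c0)//.
(* The time lag lies between h/2 and 3h/4, and coordinates differ by at most twice the square root
   of h. *)
apply: Hc => //; first by apply/andP; split; lra.
move=> i; rewrite tnth_mktuple; have := wx i; rewrite tnth_mktuple subr0 => wi.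
have zi : `|tnth z.1 i : R| <= Num.sqrt h.
  by rewrite -sqrtr_sqr ler_wsqrtr.
have : `|(tnth z.1 i : R) - tnth w.1 i| <= 2 * Num.sqrt h.
  have := ler_normB (tnth z.1 i : R) (tnth w.1 i); lra.
move=> hd; rewrite -[leLHS]real_normK ?num_real// -sh2; move: hd.
have := normr_ge0 ((tnth z.1 i : R) - tnth w.1 i); nra.
Qed.

End potential_lower_bound.

(** * Singular profiles *)

Section profile.
Context {R : realType}.
Implicit Types (eps t : R).

Definition onset (j : nat) : R := 2^-1 ^+ j.+1.

Lemma onset_gt0 j : 0 < onset j.
Proof. by rewrite exprn_gt0. Qed.

Lemma onset_lt1 j : onset j < 1.
Proof. by rewrite exprn_ilt1//; lra. Qed.

(** For [eps <= 1] the stripe starting at [onset k] ends by [2 * onset k], hence before any stripe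
    with a smaller index starts. *)
Lemma onset_lt j k : (j < k)%N -> 2 * onset k <= onset j.
Proof.
move=> jk; rewrite /onset exprS mulrA divff ?pnatr_eq0// mul1r.
by apply: ler_wiXn2l => //; lra.
Qed.

(** Open on the left, so that the elapsed time is positive on it. *)
Definition stripe eps (j : nat) : set R := `]onset j, onset j + eps * onset j]%classic.

(* The time since the last T_j, within the interval following T_j; 0 outside. *)
Definition elapsed eps t : R :=
  if pselect (exists j, stripe eps j t) is left e then t - onset (projT1 (cid e))
  else 0.

(** The stripes are disjoint for [eps <= 1], so the index picked by choice in [elapsed] can only be
    [j]. *)
Lemma elapsed_stripe eps j t : eps <= 1 -> stripe eps j t ->
  elapsed eps t = t - onset j.
Proof.
move=> eps1 tj; rewrite /elapsed; case: pselect => [e|]; last by case; exists j.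
case: cid => k /= tk; congr (_ - onset _).
move: tj tk; rewrite /stripe /= !in_itv/= => /andP[j1 j2] /andP[k1 k2].
have := onset_gt0 j; have := onset_gt0 k.
case: (@ltngtP k j) => [/onset_lt h|/onset_lt h|-> //] ? ?; exfalso; nra.
Qed.

Lemma elapsed_notin eps t : (forall j, ~ stripe eps j t) -> elapsed eps t = 0.
Proof. by move=> h; rewrite /elapsed; case: pselect => // -[j tj]; case: (h j tj). Qed.

Lemma elapsed_gt0 eps t : eps <= 1 -> 0 < elapsed eps t ->
  exists2 j, stripe eps j t & elapsed eps t = t - onset j.
Proof.
move=> eps1; case: (pselect (exists j, stripe eps j t)) => [[j tj] _|tN].
  by exists j => //; exact: elapsed_stripe.
by rewrite elapsed_notin ?ltxx// => j tj; apply: tN; exists j.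
Qed.

Lemma measurable_elapsed eps : eps <= 1 ->
  measurable_fun [set: measurableTypeR R] (elapsed eps : measurableTypeR R -> measurableTypeR R).
Proof.
move=> eps1; have mS j : measurable (stripe eps j : set (measurableTypeR R)).
  exact: measurable_itv.
have mU : measurable (\bigcup_j stripe eps j : set (measurableTypeR R)).
  exact: bigcup_measurable.
rewrite -(setUv (\bigcup_j stripe eps j)).
apply/measurable_funU => //; first exact: measurableC.
split.
  apply/measurable_fun_bigcup => // j.
  apply: (eq_measurable_fun (fun t => t - onset j)).
    by move=> t; rewrite inE => /(elapsed_stripe _ _ _ eps1) ->.
  by apply: measurable_funTS; exact: measurable_funB.
apply: (eq_measurable_fun (cst (0 : measurableTypeR R))); last exact: measurable_cst.
move=> t; rewrite inE => tN; rewrite elapsed_notin// => j tj.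
by apply: tN; exists j.
Qed.

Context {n : nat}.
Implicit Types (z w : spacetime R n) (a : R).

Definition profile_support eps : set (spacetime R n) :=
  [set z | 0 < elapsed eps z.2 /\
           forall i, (tnth z.1 i : R) ^+ 2 < elapsed eps z.2].

Definition profile a eps z : R :=
  elapsed eps z.2 `^ (- a) * \1_(profile_support eps) z.

Lemma measurable_profile_support eps : eps <= 1 ->
  measurable (profile_support eps).
Proof.
move=> eps1.
have me : measurable_fun setT (fun z : spacetime R n => elapsed eps z.2 : R).
  exact: (measurableT_comp (measurable_elapsed _ eps1) measurable_snd).
rewrite (_ : profile_support eps = [set z | 0 < elapsed eps z.2] `&`
   \bigcap_(i in [set: 'I_n]) [set z | (tnth z.1 i : R) ^+ 2 < elapsed eps z.2]); last first.
  apply/seteqP; split => z.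
    by move=> [z0 zi]; split => // i _; exact: zi.
  by move=> [z0 zi]; split => // i; exact: zi.
have mlt (g : spacetime R n -> R) : measurable_fun setT g ->
    measurable [set z | g z < elapsed eps z.2].
  move=> mg; rewrite -[X in measurable X]setTI.
  rewrite (_ : mkset _ = (fun z => g z < elapsed eps z.2) @^-1` [set true])//.
  by apply: (measurable_fun_ltr mg me) => //.
apply: measurableI; first exact: mlt.
apply: fin_bigcap_measurable => [|i _]; first exact: finite_finset.
apply: mlt; apply: measurable_funX.
exact: (measurableT_comp (measurable_tnth i) measurable_fst).
Qed.

Lemma measurable_profile a eps : eps <= 1 -> measurable_fun setT (profile a eps).
Proof.
move=> eps1; apply: measurable_funM.
  apply: (measurableT_comp (measurable_powR _)).
  exact: (measurableT_comp (measurable_elapsed _ eps1) measurable_snd).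
by apply: measurable_indic; exact: measurable_profile_support.
Qed.

Lemma profile_ge0 a eps z : 0 <= profile a eps z.
Proof. by rewrite mulr_ge0 ?powR_ge0. Qed.

(** Reduces L^p bounds to integrals of profiles. The exponent 0 is excluded because 0 to the power 0
    is 1 for [powR]. *)
Lemma profile_powR a eps p z : p != 0 ->
  profile a eps z `^ p = profile (p * a) eps z.
Proof.
move=> p0; rewrite /profile indicE; case: (z \in _); rewrite ?mulr1 ?mulr0 ?powR0//.
by rewrite -powRrM mulNr mulrC.
Qed.

Lemma profile_lt0 a eps z : (z.2 < 0 :> R) -> 0 < eps -> eps <= 1 -> profile a eps z = 0.
Proof.
move=> z0 eps0 eps1; rewrite /profile indicE memNset ?mulr0// => -[+ _].
move=> /(elapsed_gt0 _ _ eps1)[j + _]; rewrite /stripe /= in_itv/= => /andP[+ _].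
have := onset_gt0 j; lra.
Qed.

(** On this box the squared coordinates are below h/4 and the elapsed time is between h/4 and h: the
    box lies in the paraboloid, and the negative power is at least h^-a. *)
Lemma profile_ge a eps j h s t w : 0 <= a -> eps <= 1 ->
  0 < h <= eps * onset j -> onset j + h / 4 <= s -> t <= onset j + h ->
  box euclid0 (Num.sqrt h / 2) s t w -> h `^ (- a) <= profile a eps w.
Proof.
move=> a0 eps1 /andP[h0 heps] hs ht [wx /andP[wt1 wt2]].
have we : elapsed eps w.2 = (w.2 : R) - onset j.
  by apply: elapsed_stripe => //; rewrite /stripe /= in_itv/=; apply/andP; split; lra.
rewrite /profile indicE mem_set ?mulr1 ?we.
  by apply: le_powRN => //; lra.
rewrite /profile_support /= we; split => [|i]; first by lra.
have := wx i; rewrite tnth_mktuple subr0 => wi.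
apply: (@le_lt_trans _ _ (h / 4)); last by lra.
rewrite -[leLHS]real_normK ?num_real//.
have -> : h / 4 = (Num.sqrt h / 2) ^+ 2.
  by rewrite expr_div_n sqr_sqrtr ?ltW//; field.
by rewrite ler_pXn2r ?nnegrE ?divr_ge0 ?sqrtr_ge0// ltW.
Qed.

End profile.

(** * Integrability of the profiles *)

Section profile_integral.
Context {R : realType} {n : nat}.
Implicit Types (eps kappa : R).

Let piece eps j : set (spacetime R n) :=
  profile_support eps `&` [set z | stripe eps j z.2].

Let measurable_piece eps j : eps <= 1 -> measurable (piece eps j).
Proof.
move=> eps1; apply: measurableI; first exact: measurable_profile_support.
rewrite -[X in measurable X]setTI.
by apply: measurable_snd => //; exact: measurable_itv.
Qed.

(** Let l be the length of the stripe. The part with elapsed time between l 4^-(k+1) and l 4^-k fits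
    in a parabolic box of that scale and contributes a multiple of (l 4^-k)^(1 + n/2 - kappa), which
    is summable in k. *)
Lemma profile_stripe_integral eps kappa j : 0 < eps <= 1 -> 0 <= kappa ->
  kappa < 1 + n%:R / 2 ->
  (\int[spacetime_measure]_(z in piece eps j) (profile kappa eps z)%:E <=
   (4 `^ kappa * 2 ^+ n * (eps * onset j) `^ (1 + n%:R / 2 - kappa) /
    (1 - 4^-1 `^ (1 + n%:R / 2 - kappa)))%:E)%E.
Proof.
move=> /andP[eps0 eps1] k0 kn.
set s := 1 + n%:R / 2 - kappa; have s0 : 0 < s by rewrite subr_gt0.
pose l : R := eps * onset j; have l0 : 0 < l by rewrite mulr_gt0 ?onset_gt0.
have mp : measurable_fun (piece eps j)
    (fun z : spacetime R n => (profile kappa eps z)%:E).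
  apply/measurable_EFinP; apply: measurable_funTS; exact: measurable_profile.
have lk0 k : 0 < l * 4^-1 ^+ k by rewrite mulr_gt0// exprn_gt0.
apply: (@integral_le_weighted_cover _ _ _ _ _ _
  (fun k => @box R n euclid0 (Num.sqrt (l * 4^-1 ^+ k)) (onset j) (onset j + l * 4^-1 ^+ k))
  (fun k => (l * 4^-1 ^+ k.+1) `^ (- kappa))) => //.
- exact: measurable_piece.
- by move=> z _; rewrite lee_fin profile_ge0.
- by move=> k; exact: measurable_box.
- by move=> k; exact: powR_ge0.
- move=> z [zS zj].
  have ez := elapsed_stripe _ _ _ eps1 zj.
  have [e0 zi] := zS.
  move: (zj); rewrite /stripe /= in_itv/= -/l => /andP[z1 z2].
  have [||k /andP[k1 k2]] := @geometric_scale R 4^-1 (elapsed eps z.2 / l).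
  - by apply/andP; split; lra.
  - by rewrite divr_gt0//= ler_pdivrMr// mul1r ez; lra.
  move: k1 k2; rewrite ltr_pdivlMr// ler_pdivrMr// ![_ * l]mulrC => k1 k2.
  exists k.
    split=> [i|/=]; last by rewrite z1/=; move: k2; rewrite ez; lra.
    rewrite tnth_mktuple subr0 -sqrtr_sqr ltr_sqrt//.
    exact: lt_le_trans (zi i) k2.
  rewrite lee_fin /profile indicE mem_set// mulr1.
  by apply: le_powRN => //; exact: ltW.
- move=> k.
  rewrite [X in (_ * X)%E](_ : _ = ((2 * Num.sqrt (l * 4^-1 ^+ k)) ^+ n *
     (onset j + l * 4^-1 ^+ k - onset j))%:E); last first.
    by apply: box_measure; rewrite ?sqrtr_ge0 ?lerDl// ltW.
  rewrite -EFinM lee_fin addrAC subrr add0r exprMn.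
  rewrite (@expr_powR_half _ _ (Num.sqrt _)) ?sqrtr_ge0// sqr_sqrtr ?(ltW (lk0 _))//.
  rewrite exprS -/l [l * (4^-1 * _)]mulrCA.
  rewrite [(4^-1 * _) `^ _]powRM ?(ltW (lk0 _))//.
  rewrite -{1}[4^-1]powR_inv1// -powRrM mulN1r opprK.
  have -> : (4^-1 `^ s) ^+ k = (4^-1 ^+ k) `^ s.
    by rewrite -powR_mulrn ?powR_ge0// -powRrM mulrC powRrM powR_mulrn.
  have -> : 4 `^ kappa * 2 ^+ n * l `^ s * (4^-1 ^+ k) `^ s =
      4 `^ kappa * 2 ^+ n * (l * 4^-1 ^+ k) `^ s.
    by rewrite powRM ?exprn_ge0 ?(ltW l0)// !mulrA.
  have := lk0 k; set q := l * 4^-1 ^+ k => q0.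
  have -> : q `^ s = q `^ (- kappa) * q `^ (n%:R / 2) * q.
    rewrite -{4}[q]powRr1 ?(ltW q0)// -!powRD ?(gt_eqF q0) ?implybT//.
    by congr (powR _ _); rewrite /s; ring.
  by rewrite le_eqVlt; apply/orP; left; apply/eqP; ring.
- rewrite powR_gt0//= -[ltRHS](congr1 (@^~ s) (@powR1 R)).
  by apply: gt0_ltr_powR => //; rewrite ?nnegrE//; lra.
Qed.

(** The bound on stripe j is a multiple of [onset j] to the positive power 1 + n/2 - kappa, hence
    geometric in j. *)
Lemma profile_integral_lty eps kappa : 0 < eps <= 1 -> 0 <= kappa ->
  kappa < 1 + n%:R / 2 ->
  (\int[@spacetime_measure R n]_z (profile kappa eps z)%:E < +oo)%E.
Proof.
move=> eps01 k0 kn; have /andP[eps0 eps1] := eps01.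
set s := 1 + n%:R / 2 - kappa; have s0 : 0 < s by rewrite subr_gt0.
pose th : R := 2^-1 `^ s.
have th01 : 0 < th < 1.
  rewrite powR_gt0//= -[ltRHS](congr1 (@^~ s) (@powR1 R)).
  by apply: gt0_ltr_powR => //; rewrite ?nnegrE//; lra.
pose F (z : spacetime R n) : \bar R := (profile kappa eps z)%:E.
have mF : measurable_fun setT F by apply/measurable_EFinP; exact: measurable_profile.
have F0 z : (0 <= F z)%E by rewrite lee_fin profile_ge0.
(* The last factor [th] is there because [onset 0] is 1/2 rather than 1. *)
pose C : R := 4 `^ kappa * 2 ^+ n / (1 - 4^-1 `^ s) * eps `^ s * th.
apply: (@le_lt_trans _ _ (C / (1 - th))%:E); last exact: ltry.
apply: (@integral_le_geometric_cover _ _ _ _ _ _ (fun j => F \_ (piece eps j))) => //.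
- by move=> z _; exact: F0.
- move=> j; apply/(measurable_restrictT _ (measurable_piece _ j eps1)).
  exact: measurable_funTS.
- by move=> j z _; apply: erestrict_ge0 => ? _; exact: F0.
- move=> z _; have [zS|zN] := pselect (profile_support eps z).
    have [e0 _] := zS; have [j zj _] := elapsed_gt0 _ _ eps1 e0.
    by exists j; rewrite patchE mem_set.
  exists 0%N; rewrite patchE; case: ifPn => // _.
  by rewrite /F /profile indicE memNset// mulr0.
- move=> j; rewrite -integral_mkcond.
  apply: (le_trans (profile_stripe_integral _ _ j eps01 k0 kn)); rewrite lee_fin -/s.
  rewrite powRM ?(ltW eps0) ?(ltW (onset_gt0 _))//.
  have -> : onset j `^ s = th * th ^+ j.
    rewrite -exprS -[th ^+ _]powR_mulrn ?powR_ge0// -powRrM mulrC powRrM.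
    by rewrite powR_mulrn.
  by rewrite le_eqVlt; apply/orP; left; apply/eqP; rewrite /C; ring.
Qed.

End profile_integral.

(** * Norms with finite exponent, and potentials as elements of Y^p_alpha *)

Section Lnorm_real.
Context {R : realType} {n : nat}.
Implicit Types (f : spacetime R n -> R) (D : set (spacetime R n)) (p : R).

Lemma Lnorm_on_real D p f : p != 0 -> Lnorm_on D p%:E f =
  ((\int[spacetime_measure]_(z in D) (`|f z| `^ p)%:E) `^ p^-1)%E.
Proof.
move=> p0; rewrite /Lnorm_on unlock; congr poweR.
rewrite [RHS]integral_mkcond; apply: eq_integral => z _.
rewrite !patchE; case: ifPn => _; first by rewrite /comp abse_EFin poweR_EFin.
by rewrite abse0 poweR0r.
Qed.

Lemma X_space_of_integral p f : 1 <= p -> measurable_fun setT f ->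
  (forall z, 0 <= f z) ->
  (\int[spacetime_measure]_z (f z `^ p)%:E < +oo)%E -> X_space p f.
Proof.
move=> p1 mf f0 intf; have p0 : 0 < p by lra.
split=> // T; rewrite Lnorm_on_real ?gt_eqF//.
apply/poweR_lty/(le_lt_trans _ intf).
have mT : measurable [set z : spacetime R n | (z.2 < T :> R)].
  rewrite -[X in measurable X]setTI.
  rewrite (_ : mkset _ = snd @^-1` `]-oo, T[%classic).
    by apply: measurable_snd => //; exact: measurable_itv.
  by apply/seteqP; split => z /=; rewrite in_itv.
have mfp : measurable_fun setT (fun z => (f z `^ p)%:E).
  by apply/measurable_EFinP/(measurableT_comp (measurable_powR _)).
under eq_integral => z _ do rewrite ger0_norm//.
by apply: ge0_subset_integral => // z _; rewrite lee_fin powR_ge0.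
Qed.

(** Integrability of [f] makes the potential finite almost everywhere, so [fine] alters it on a null
    set only; integrability of f^p puts [f] in X^p. *)
Lemma frac_heat_J_op p alpha f : 1 <= p -> 0 < alpha -> alpha <= 1 + n%:R / 2 ->
  measurable_fun setT f -> (forall z, 0 <= f z) ->
  (\int[spacetime_measure]_z (f z)%:E < +oo)%E ->
  (\int[spacetime_measure]_z (f z `^ p)%:E < +oo)%E ->
  frac_heat p alpha (fun z => fine (J_op alpha f z)) f.
Proof.
move=> p1 alpha0 alphan mf f0 intf intfp.
have Xf : X_space p f by exact: X_space_of_integral.
have Jf : J_ae_eq alpha f (fun z => fine (J_op alpha f z)).
  have := J_op_ae_fin _ alpha0 alphan _ mf f0 intf.
  by apply: filterS => z /fineK.
split=> //; split; last by exists f.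
have mJ := measurable_J_op _ alpha0 _ mf f0.
exact: (measurableT_comp (fine_measurable measurableT) mJ).
Qed.

End Lnorm_real.

(** * Domination of one profile by a power of the potential of the other *)

Section profile_dominance.
Context {R : realType} {n : nat}.
Implicit Types (a b alpha lam : R).

Lemma powRN_large (e M : R) : 0 < e ->
  exists2 h0 : R, 0 < h0 & forall h, 0 < h <= h0 -> M <= h `^ (- e).
Proof.
(* The maximum with 1 keeps the base of the next power positive. *)
move=> e0; pose M1 := Num.max M 1.
have M10 : 0 < M1 by rewrite lt_max ltr01 orbT.
exists (M1 `^ (- e^-1)); first exact: powR_gt0.
move=> h /andP[h0 hM]; apply: (@le_trans _ _ M1); first by rewrite le_max lexx.
apply: (le_trans _ (le_powRN _ _ _ (ltW e0) h0 hM)).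
by rewrite -powRrM mulrNN mulVf ?gt_eqF// powRr1// ltW.
Qed.

(** With h the elapsed time at z, the potential is at least c h^(alpha - b). Its power [lam] is h^-a
    times c^lam h^-(lam (b - alpha) - a), a factor at least 1 once h, which is at most [eps], is
    small. Finiteness is assumed since [fine] sends +oo to 0. *)
Lemma profile_le_J_op_powR alpha a b lam : 0 < alpha -> alpha <= 1 + n%:R / 2 ->
  0 < lam -> 0 <= b -> a < lam * (b - alpha) ->
  exists2 eps0 : R, 0 < eps0 & forall eps (z : spacetime R n),
    0 < eps -> eps <= eps0 -> eps <= 1 ->
    J_op alpha (profile b eps) z \is a fin_num ->
    profile a eps z <= fine (J_op alpha (profile b eps) z) `^ lam.
Proof.
move=> al0 aln lam0 b0 ab.
have [c c0 Hc] := J_op_ge alpha al0 aln (n := n).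
have [eps0 eps00 Heps] := @powRN_large (lam * (b - alpha) - a) (c `^ (- lam))
  ltac:(by rewrite subr_gt0).
exists eps0 => // eps z eps_gt0 leps eps1 Jfin.
have [zS|zN] := pselect (profile_support eps z); last first.
  by rewrite /profile indicE memNset// mulr0 powR_ge0.
have [h0 zi] := zS.
rewrite {1}/profile indicE mem_set// mulr1.
have [j zj ez] := elapsed_gt0 _ _ eps1 h0.
set h := elapsed eps z.2 in h0 zi ez *.
have hj : h <= eps * onset j.
  by move: zj; rewrite /stripe /= in_itv/= ez => /andP[_]; lra.
have heps : h <= eps.
  rewrite (le_trans hj)// ler_piMr ?(ltW eps_gt0)// ltW//; exact: onset_lt1.
have HJ : c * h `^ (alpha - b) <= fine (J_op alpha (profile b eps) z).
  rewrite -lee_fin fineK//.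
  have -> : c * h `^ (alpha - b) = c * h `^ (- b) * h `^ alpha.
    by rewrite -mulrA -powRD ?(gt_eqF h0) ?implybT// addrC.
  apply: Hc => //.
  - exact: measurable_profile.
  - by move=> w; exact: profile_ge0.
  - exact: powR_ge0.
  - by move=> i; exact: ltW.
  (* As z.2 = T_j + h, the box of [J_op_ge] covers the times from T_j + h/4 to T_j + h/2. *)
  - move=> w; apply: (profile_ge b eps j h) => //; first by rewrite h0.
      by rewrite ez; lra.
    by rewrite ez; lra.
have x0 : 0 <= c * h `^ (alpha - b) by rewrite mulr_ge0 ?powR_ge0 ?ltW.
apply: le_trans (le_powR _ _ _ (ltW lam0) x0 HJ).
rewrite powRM ?powR_ge0 ?(ltW c0)// -powRrM.
have -> : (alpha - b) * lam = - a - (lam * (b - alpha) - a) by ring.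
rewrite powRD ?(gt_eqF h0) ?implybT// mulrCA ler_peMr ?powR_ge0//.
have cl : 0 < c `^ lam by rewrite powR_gt0.
rewrite -ler_pdivrMl// mulr1 -powRN; apply: Heps.
by rewrite h0 (le_trans heps).
Qed.

End profile_dominance.

(** * Infinite norms on the regions R_j *)

Section parabolic_region.
Context {R : realType} {n : nat}.

Lemma measurable_parabolic_region (t : R) : 0 < t ->
  measurable (@parabolic_region R n t).
Proof.
move=> t0.
pose N (z : spacetime R n) : R := \sum_(i < n) (tnth z.1 i : R) ^+ 2.
have mN : measurable_fun setT N.
  apply: measurable_sum => i; apply: measurable_funX.
  exact: (measurableT_comp (measurable_tnth i) measurable_fst).
rewrite (_ : parabolic_region t =
    (fun z => N z < t) @^-1` [set true] `&` snd @^-1` `]t, 2 * t[%classic).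
  apply: measurableI; rewrite -[X in measurable X]setTI.
    by apply: measurable_fun_ltr.
  by apply: measurable_snd => //; exact: measurable_itv.
by apply/seteqP; split => z;
  rewrite /parabolic_region /euclid_norm /= in_itv/= ltr_sqrt.
Qed.

(** Each of the n squared coordinates is at most h/4, so |x|^2 <= n h / 4 < t. *)
Lemma box_sub_parabolic_region (t h a b : R) : 0 < t -> 0 < h -> n%:R * h <= t ->
  t <= a -> b < 2 * t ->
  box euclid0 (Num.sqrt h / 2) a b `<=` @parabolic_region R n t.
Proof.
move=> t0 h0 nh ta bt z [zx /andP[z1 z2]]; split; last by apply/andP; split; lra.
rewrite ltr_sqrt//; apply: (@le_lt_trans _ _ (\sum_(i < n) h / 4)).
  apply: ler_sum => i _; have := zx i; rewrite tnth_mktuple subr0 => zi.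
  rewrite -[leLHS]real_normK ?num_real//.
  have -> : h / 4 = (Num.sqrt h / 2) ^+ 2.
    by rewrite expr_div_n sqr_sqrtr ?ltW//; field.
  by rewrite ler_pXn2r ?nnegrE ?divr_ge0 ?sqrtr_ge0// ltW.
by rewrite sumr_const card_ord -mulr_natl; have := ler0n R n; nra.
Qed.

End parabolic_region.

Section profile_norm.
Context {R : realType} {n : nat}.

(** As h decreases to 0, the boxes [B h] approach the vertex (0, T_j). On them the profile is at
    least h^-a, and their measure is of order h^(1 + n/2), so the integral of the r-th power over
    [B h] exceeds a multiple of h^(1 + n/2 - a r), which is unbounded. Since [g] only has to
    dominate the profile, this serves the densities and the powers of the solutions alike. *)
Lemma Lnorm_on_profile_pinfty (a eps : R) (j : nat) (r : \bar R)
    (g : spacetime R n -> R) :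
  0 < a -> 0 < eps <= 1 -> (0 < r)%E ->
  ((1 + n%:R / 2)%:E < a%:E * r)%E -> measurable_fun setT g ->
  {ae spacetime_measure, forall z, profile a eps z <= g z} ->
  Lnorm_on (parabolic_region (onset j)) r g = +oo%E.
Proof.
move=> a0 /andP[eps0 eps1] r0 ar mg ae_g.
set D := parabolic_region (onset j).
have T0 := @onset_gt0 R j.
have mD : measurable D by exact: measurable_parabolic_region.
(* The first term keeps [B h] inside the stripe, the second gives n h <= T_j, and the half makes T_j
   + h < 2 T_j strict. *)
pose h1 : R := Num.min (eps * onset j) (onset j / n.+1%:R) / 2.
have h10 : 0 < h1 by rewrite divr_gt0// lt_min mulr_gt0//= divr_gt0.
pose B h : set (spacetime R n) := box euclid0 (Num.sqrt h / 2) (onset j + h / 4) (onset j + h).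
have mB h : measurable (B h) by exact: measurable_box.
have BD h : 0 < h <= h1 -> B h `<=` D.
  move=> /andP[h0 hh1].
  have : h1 <= eps * onset j / 2 by rewrite ler_wpM2r// ge_min lexx.
  have : h1 <= onset j / n.+1%:R / 2 by rewrite ler_wpM2r// ge_min lexx orbT.
  move=> u1 u2; apply: box_sub_parabolic_region => //.
  - apply: (@le_trans _ _ (n.+1%:R * h)).
      by rewrite ler_wpM2r ?(ltW h0)// ler_nat.
    rewrite -ler_pdivlMl// mulrC (le_trans hh1)// (le_trans u1)//.
    by rewrite ler_pdivrMr// ler_peMr ?divr_ge0 ?(ltW T0)// ler1n.
  - by lra.
  - by nra.
have profB h w : 0 < h <= h1 -> B h w -> h `^ (- a) <= profile a eps w.
  move=> /andP[h0 hh1]; apply: (profile_ge a eps j h) => //; first exact: ltW.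
  have : h1 <= eps * onset j / 2 by rewrite ler_wpM2r// ge_min lexx.
  by move=> u; apply/andP; split=> //; have : 0 < eps * onset j by [rewrite mulr_gt0]; lra.
have muB h : 0 < h -> spacetime_measure (B h) = (h `^ (n%:R / 2) * (3 / 4 * h))%:E.
  move=> h0; rewrite box_measure ?divr_ge0 ?sqrtr_ge0//; last by lra.
  rewrite [2 * _]mulrC divfK ?pnatr_eq0// expr_powR_half ?sqrtr_ge0//.
  by rewrite sqr_sqrtr ?(ltW h0)//; congr (_ * _)%:E; field.
have muB0 h : 0 < h -> (0 < spacetime_measure (B h))%E.
  by move=> h0; rewrite muB// lte_fin !mulr_gt0 ?powR_gt0.
case: r r0 ar => [r| |//] r0 ar; last first.
  (* For r = +oo the norm is the essential supremum provided that the whole space has positive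
     measure. *)
  have muT : (0 < @spacetime_measure R n setT)%E.
    by rewrite (lt_le_trans (muB0 _ h10))// le_measure ?inE.
  rewrite /Lnorm_on unlock muT; apply/eqyP => M M0; rewrite leNgt; apply/negP => /ltW.
  move/ess_supP => hM.
  have [h2 h20 Hh2] := @powRN_large R a (M + 1) a0.
  pose h := Num.min h1 h2.
  have h0 : 0 < h by rewrite lt_min h10.
  have hh1 : 0 < h <= h1 by rewrite h0 ge_min lexx.
  (* Almost everywhere on [B h] one has |g| >= h^-a >= M + 1, so an essential bound M would make
     [B h] negligible. *)
  have : spacetime_measure.-negligible (B h).
    apply: (negligibleS _ (negligibleU ae_g hM)) => z Bz /=.
    apply/not_andP => -[pz].
    rewrite patchE mem_set; last exact: BD Bz.
    rewrite /= lee_fin => gM.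
    have := Hh2 h; rewrite h0 ge_min lexx orbT => /(_ isT).
    have := profB _ _ hh1 Bz; have := ler_norm (g z); lra.
  move/(negligibleP _ (mB h)) => B0.
  by have := muB0 _ h0; rewrite B0 ltxx.
rewrite lte_fin in r0; have {}ar : 1 + n%:R / 2 < a * r := ar.
rewrite Lnorm_on_real ?gt_eqF//; apply: eqy_poweR; first by rewrite invr_gt0.
apply/eqyP => M M0.
(* The factor 4/3 compensates the 3/4 in the measure of [B h]. *)
have [h2 h20 Hh2] := @powRN_large R (a * r - (1 + n%:R / 2)) (4 / 3 * M)
  ltac:(by rewrite subr_gt0).
pose h := Num.min h1 h2.
have h0 : 0 < h by rewrite lt_min h10.
have hh1 : 0 < h <= h1 by rewrite h0 ge_min lexx.
have mgr : measurable_fun setT (fun z => (`|g z| `^ r)%:E).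
  apply/measurable_EFinP/(measurableT_comp (measurable_powR _)).
  exact: measurableT_comp.
apply: (@le_trans _ _ (\int[spacetime_measure]_(z in B h) (`|g z| `^ r)%:E)%E); last first.
  by apply: ge0_subset_integral => //; [exact: measurable_funTS|exact: BD].
apply: (@le_trans _ _ (\int[spacetime_measure]_(z in B h) (h `^ (- a * r))%:E)%E).
  rewrite (@integral_cst _ _ _ _ _ (mB h) (h `^ (- a * r))%:E).
  rewrite [X in (_ * X)%E](_ : _ = (h `^ (n%:R / 2) * (3 / 4 * h))%:E); last exact: muB.
  rewrite -EFinM lee_fin.
  have := Hh2 h; rewrite h0 ge_min lexx orbT => /(_ isT).
  have -> : h `^ (- (a * r - (1 + n%:R / 2))) = h `^ (- a * r) * h `^ (n%:R / 2) * h.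
    rewrite -{4}[h]powRr1 ?(ltW h0)// -!powRD ?(gt_eqF h0) ?implybT//.
    by congr (powR _ _); ring.
  by set x := h `^ (- a * r); set y := h `^ (n%:R / 2); lra.
apply: ae_ge0_le_integral => //.
- by move=> z _; rewrite lee_fin powR_ge0.
- exact: measurable_funTS.
apply: filterS ae_g => z pz Bz; rewrite lee_fin powRrM.
  apply: le_powR => //; first exact: ltW.
    exact: powR_ge0.
  by rewrite (le_trans (profB _ _ hh1 Bz))// (le_trans pz)// ler_norm.
Qed.

End profile_norm.

(** * Choice of the exponents *)

Section exponents.
Context {R : realType}.

(** Here 2 D stands for n + 2. First b is chosen between beta + A / lambda and B, where A = D / p
    and B is its upper limit; then a is chosen just below A. *)
Lemma exponents_exist (D p q lambda sigma alpha beta : R) (r s : \bar R) :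
  0 < D -> 1 <= p -> 1 <= q -> 0 < lambda -> 0 < sigma -> 0 < alpha -> 0 < beta ->
  (2 * D - 2 * p * alpha) * q ^+ 2 * sigma
    <= (2 * D - 2 * q * beta) * p ^+ 2 * lambda ->
  2 * p * alpha < 2 * D ->
  2 * p * beta / (2 * D - 2 * p * alpha)
    + 2 * D / ((2 * D - 2 * p * alpha) * lambda) < sigma ->
  (p%:E < r)%E ->
  ((Num.max q (q * (2 * D * p / ((2 * D - 2 * p * alpha) * q)) / sigma))%:E < s)%E ->
  exists a b : R, [/\ 0 < a, 0 < b, p * a < D, q * b < D &
    [/\ a < lambda * (b - beta), b < sigma * (a - alpha),
        (D%:E < a%:E * r)%E & (D%:E < b%:E * s)%E]].
Proof.
move=> D0 p1 q1 lam0 sig0 al0 be0 Hpq pal Hmu pr s0s.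
have p0 : 0 < p by lra.
have q0 : 0 < q by lra.
pose A : R := D / p; have A0 : 0 < A by rewrite divr_gt0.
have eA : D = p * A by rewrite /A mulrC divfK// gt_eqF.
have Aal : 0 < A - alpha.
  by rewrite subr_gt0 /A ltr_pdivlMr// mulrC; lra.
have e1 : 2 * D - 2 * p * alpha = 2 * p * (A - alpha) by rewrite eA; ring.
pose Q : R := D / q; have Q0 : 0 < Q by rewrite divr_gt0.
have eQ : D = q * Q by rewrite /Q mulrC divfK// gt_eqF.
(* b < Q means q b < D, and b < sigma (A - alpha) leaves room for some a < A with b < sigma (a -
   alpha). *)
pose B : R := Num.min Q (sigma * (A - alpha)).
(* This is the hypothesis that sigma exceeds mu(lambda), multiplied by A - alpha. *)
have SB : beta + A / lambda < sigma * (A - alpha).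
  move: Hmu; rewrite e1.
  have -> : 2 * p * beta / (2 * p * (A - alpha)) + 2 * D / (2 * p * (A - alpha) * lambda)
     = (beta + A / lambda) / (A - alpha).
    by rewrite eA; field; rewrite !gt_eqF.
  by rewrite ltr_pdivrMr.
have B1 : beta + A / lambda < B.
  rewrite lt_min SB andbT.
  case: (leP (sigma * (A - alpha)) Q) => [|QS]; first exact: lt_le_trans.
  (* When Q is the smaller bound, Q < sigma (A - alpha) combines with [Hpq]; dividing by p^2 q
     lambda gives A / lambda < Q - beta. *)
  have H2 : p * q * D < (D - q * beta) * p ^+ 2 * lambda.
    have h : (D - p * alpha) * q ^+ 2 * sigma <= (D - q * beta) * p ^+ 2 * lambda by lra.
    apply: lt_le_trans h.
    have -> : p * q * D = (p * q ^+ 2) * Q by rewrite eQ; ring.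
    have -> : (D - p * alpha) * q ^+ 2 * sigma = (p * q ^+ 2) * (sigma * (A - alpha)).
      by rewrite {1}eA; ring.
    by rewrite ltr_pM2l// mulr_gt0// exprn_gt0.
  have pql : 0 < p ^+ 2 * q * lambda by rewrite !mulr_gt0.
  rewrite -(ltr_pM2l pql).
  have -> : p ^+ 2 * q * lambda * (beta + A / lambda) =
      p * q * D + q * beta * p ^+ 2 * lambda.
    by rewrite eA; field; rewrite gt_eqF.
  have -> : p ^+ 2 * q * lambda * Q = D * p ^+ 2 * lambda by rewrite eQ; ring.
  by move: H2; rewrite -!mulrA mulrBl !mulrA; lra.
have B0 : 0 < B by apply: lt_trans B1; rewrite addr_gt0// divr_gt0.
(* The threshold is D / s, or 0 for s = +oo. The two members of the maximum s_0 correspond to the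
   two members of the minimum B. *)
have [b1 b1B Hb1] : exists2 b1 : R, b1 < B & forall b, 0 < b -> b1 < b -> (D%:E < b%:E * s)%E.
  case: s s0s => [s| |//] s0s; last first.
    by exists 0 => // b b0 _; rewrite gt0_muley ?lte_fin// ltry.
  move: s0s; rewrite lte_fin gt_max => /andP[qs]; rewrite e1.
  have -> : q * (2 * D * p / (2 * p * (A - alpha) * q)) / sigma =
      D / (sigma * (A - alpha)).
    by field; rewrite !gt_eqF.
  rewrite ltr_pdivrMr ?mulr_gt0// => Ds.
  have s0 : 0 < s by exact: lt_trans q0 qs.
  exists (D / s).
    rewrite lt_min; apply/andP; split; rewrite ltr_pdivrMr// mulrC//.
    by rewrite [ltLHS]eQ ltr_pM2r.
  by move=> b _; rewrite ltr_pdivrMr// -EFinM lte_fin.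
have [a1 a1A Ha1] : exists2 a1 : R, a1 < A & forall a, 0 < a -> a1 < a -> (D%:E < a%:E * r)%E.
  case: r pr => [r| |//] pr; last first.
    by exists 0 => // a a0 _; rewrite gt0_muley ?lte_fin// ltry.
  rewrite lte_fin in pr; have r0 : 0 < r by exact: lt_trans p0 pr.
  exists (D / r); first by rewrite ltr_pdivrMr// [ltLHS]eA mulrC ltr_pM2l.
  by move=> a _; rewrite ltr_pdivrMr// -EFinM lte_fin.
pose m := Num.max b1 (beta + A / lambda).
have mB : m < B by rewrite gt_max b1B.
pose b := (m + B) / 2.
have bm : m < b by rewrite /b; lra.
have bB : b < B by rewrite /b; lra.
move: (bm); rewrite gt_max => /andP[b1b bb].
have [bQ bS] : b < Q /\ b < sigma * (A - alpha) by apply/andP; rewrite -lt_min.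
(* alpha + b / sigma < A restates b < sigma (A - alpha). The bound a < lambda (b - beta) follows
   from a < A, as b > beta + A / lambda. *)
pose m' := Num.max a1 (alpha + b / sigma).
have m'A : m' < A.
  by rewrite gt_max a1A/= -ltrBrDl ltr_pdivrMr// mulrC.
pose a := (m' + A) / 2.
have am : m' < a by rewrite /a; lra.
have aA : a < A by rewrite /a; lra.
move: (am); rewrite gt_max => /andP[a1a aa].
have b0 : 0 < b by apply: lt_trans bb; rewrite addr_gt0// divr_gt0.
have a0 : 0 < a by apply: lt_trans aa; rewrite addr_gt0// divr_gt0.
exists a, b; split => //.
- by rewrite eA ltr_pM2l.
- by rewrite eQ ltr_pM2l.
split.
- apply: (lt_trans aA); rewrite -ltr_pdivrMl//; rewrite mulrC; lra.
- by move: aa; rewrite -ltrBrDl ltr_pdivrMr// mulrC.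
- exact: Ha1.
- exact: Hb1.
Qed.

End exponents.

(** * Construction of the solutions *)

Lemma admissible_order_le {R : realType} (n : nat) (p alpha : R) :
  1 <= p -> admissible_order n p alpha -> alpha <= 1 + n%:R / 2.
Proof.
move=> p1 ap; have {}ap : alpha <= (n%:R + 2) / (2 * p).
  by case: ap => [[_ /andP[_ /ltW]]|[_ /andP[]]].
apply: (le_trans ap); rewrite ler_pdivrMr; last by lra.
by have := ler0n R n; nra.
Qed.

(** As p >= 1, the bound on p a also bounds a, so both the profile and its p-th power are
    integrable. *)
Lemma frac_heat_profile {R : realType} (n : nat) (p alpha a eps : R) :
  1 <= p -> 0 < alpha -> alpha <= 1 + n%:R / 2 -> 0 < a ->
  p * a < 1 + n%:R / 2 -> 0 < eps <= 1 ->
  frac_heat p alpha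
    (fun z : spacetime R n => fine (J_op alpha (profile a eps) z)) (profile a eps).
Proof.
move=> p1 al0 aln a0 pa eps01; have /andP[_ eps1] := eps01.
apply: frac_heat_J_op => //.
- exact: measurable_profile.
- exact: profile_ge0.
- by apply: profile_integral_lty => //; [exact: ltW|nra].
- under eq_integral => z _ do rewrite profile_powR ?gt_eqF ?(lt_le_trans ltr01 p1)//.
  by apply: profile_integral_lty => //; rewrite mulr_ge0 ?(ltW a0)// (le_trans ler01).
Qed.

(** Causality: only times before [z.2] enter, and the profile vanishes at negative times. *)
Lemma J_op_profile_lt0 {R : realType} (n : nat) (alpha a eps : R) (z : spacetime R n) :
  0 < eps <= 1 -> (z.2 < 0 :> R) -> J_op alpha (profile a eps) z = 0%E.
Proof.
move=> /andP[eps0 eps1] z0; rewrite /J_op integral0_eq// => w /= wz.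
by rewrite profile_lt0 ?mulr0//; exact: lt_trans wz z0.
Qed.

Lemma cvg_onset (R : realType) : (@onset R) @ \oo --> (0 : R).
Proof.
rewrite (_ : @onset R = (fun k => 2^-1 ^+ (k + 1)%N)).
  rewrite (cvg_shiftn 1 (fun k => 2^-1 ^+ k : R)); apply: cvg_expr.
  by rewrite ger0_norm//; lra.
by apply/funext => k; rewrite addn1.
Qed.

Theorem theorem2p5 (R : realType) (n : nat) (p q lambda sigma alpha beta : R)
    (r s : \bar R) :
  let d : R := n%:R + 2 in
  let mu : R := 2 * p * beta / (d - 2 * p * alpha)
                + d / ((d - 2 * p * alpha) * lambda) in
  let sigma0 : R := d * p / ((d - 2 * p * alpha) * q) in
  let s0 : R := Num.max q (q * sigma0 / sigma) in
  (1 <= n)%N -> 1 <= p -> 1 <= q ->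
  0 < lambda -> 0 < sigma -> 0 < alpha -> 0 < beta ->
  admissible_order n p alpha -> admissible_order n q beta ->
  (d - 2 * p * alpha) * q ^+ 2 * sigma
    <= (d - 2 * q * beta) * p ^+ 2 * lambda ->
  2 * p * alpha < d ->
  mu < sigma ->
  (p%:E < r)%E -> (s0%:E < s)%E ->
  exists (u v : spacetime R n -> R) (Au Bv : spacetime R n -> R)
         (t : nat -> R),
    [/\ Y_space p alpha u /\ Y_space q beta v,
        frac_heat p alpha u Au /\ frac_heat q beta v Bv,
        [/\ {ae spacetime_measure, forall z, 0 <= Au z <= v z `^ lambda},
            {ae spacetime_measure, forall z, 0 <= Bv z <= u z `^ sigma} &
            {ae spacetime_measure, forall z : spacetime R n,
              (z.2 < 0 :> R) -> u z = 0 /\ v z = 0}],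
        (forall j, 0 < t j < 1) /\ t @ \oo --> (0 : R) &
        forall j,
          [/\ Lnorm_on (parabolic_region (t j)) r (fun z => v z `^ lambda) = +oo%E,
              Lnorm_on (parabolic_region (t j)) r Au = +oo%E,
              Lnorm_on (parabolic_region (t j)) s (fun z => u z `^ sigma) = +oo%E &
              Lnorm_on (parabolic_region (t j)) s Bv = +oo%E]].
Proof.
move=> d mu sigma0 s0 n1 p1 q1 lam0 sig0 al0 be0 adm_p adm_q.
have aln := admissible_order_le _ _ _ p1 adm_p.
have ben := admissible_order_le _ _ _ q1 adm_q.
have n0 := ler0n R n.
rewrite /s0 /sigma0 /mu (_ : d = 2 * (1 + n%:R / 2)); last by rewrite /d; field.
set D := 1 + n%:R / 2 => Hpq pal Hmu pr s0s.
have D0 : 0 < D by rewrite /D; lra.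
have [a [b [a0 b0 paD qbD [a_lt b_lt aDr bDs]]]] := exponents_exist D p q
  lambda sigma alpha beta r s D0 p1 q1 lam0 sig0 al0 be0 Hpq pal Hmu pr s0s.
have [e1 e10 He1] := profile_le_J_op_powR beta a b lambda be0 ben lam0 (ltW b0) a_lt.
have [e2 e20 He2] := profile_le_J_op_powR alpha b a sigma al0 aln sig0 (ltW a0) b_lt.
(* One [eps] serves both inequalities and keeps the stripes disjoint. *)
pose eps : R := Num.min 1 (Num.min e1 e2).
have eps0 : 0 < eps by rewrite !lt_min ltr01 e10.
have eps1 : eps <= 1 by rewrite ge_min lexx.
have ee1 : eps <= e1 by rewrite !ge_min lexx orbT.
have ee2 : eps <= e2 by rewrite !ge_min lexx !orbT.
have eps01 : 0 < eps <= 1 by rewrite eps0.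
pose f : spacetime R n -> R := profile a eps.
pose g : spacetime R n -> R := profile b eps.
have fheat := frac_heat_profile n p alpha a eps p1 al0 aln a0 paD eps01.
have gheat := frac_heat_profile n q beta b eps q1 be0 ben b0 qbD eps01.
pose u (z : spacetime R n) : R := fine (J_op alpha f z).
pose v (z : spacetime R n) : R := fine (J_op beta g z).
have [Yu _ Ju] := fheat; have [Yv _ Jv] := gheat.
have fv : {ae spacetime_measure, forall z, f z <= v z `^ lambda}.
  (* [Jz] identifies the potential at z with a real number, which gives the finiteness that [He1]
     asks for. *)
  by apply: filterS Jv => z Jz; apply: He1 => //; rewrite -/g -Jz.
have gu : {ae spacetime_measure, forall z, g z <= u z `^ sigma}.
  by apply: filterS Ju => z Jz; apply: He2 => //; rewrite -/f -Jz.
have mpow h x : measurable_fun setT h ->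
    measurable_fun setT (fun z : spacetime R n => h z `^ x : R).
  exact: (measurableT_comp (measurable_powR _)).
have r0 : (0 < r)%E by apply: lt_trans pr; rewrite lte_fin (lt_le_trans ltr01 p1).
have s'0 : (0 < s)%E.
  by apply: le_lt_trans s0s; rewrite lee_fin le_max (le_trans ler01 q1).
exists u, v, f, g, onset; split.
- by split; [exact: Yu|exact: Yv].
- by split; [exact: fheat|exact: gheat].
- split.
  + by apply: filterS fv => z hz; rewrite profile_ge0 hz.
  + by apply: filterS gu => z hz; rewrite profile_ge0 hz.
  + by apply: aeW => z z0; rewrite /u /v !J_op_profile_lt0.
- by split; [move=> j; rewrite onset_gt0 onset_lt1|exact: cvg_onset].
- move=> j; split.
  (* The power of v inherits the infinite norm from the profile it dominates almost everywhere. *)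
  + apply: (Lnorm_on_profile_pinfty a eps j r _ a0 eps01 r0 aDr _ fv).
    by apply: mpow; case: Yv.
  + apply: (Lnorm_on_profile_pinfty a eps j r _ a0 eps01 r0 aDr); first exact: measurable_profile.
    by apply: aeW => z; exact: lexx.
  + apply: (Lnorm_on_profile_pinfty b eps j s _ b0 eps01 s'0 bDs _ gu).
    by apply: mpow; case: Yu.
  + apply: (Lnorm_on_profile_pinfty b eps j s _ b0 eps01 s'0 bDs); first exact: measurable_profile.
    by apply: aeW => z; exact: lexx.
Qed.
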